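(* Let $A$ be the generator of a polynomially stable semigroup $(T(t))_{t\ge0}$ with parameter $\alpha>0$ on a Banach space $X$, and let $U$ be another Banach space. Suppose that the nonlinear operator $F:X\times U\to X$ is decomposed as $F(\xi,v)=Bv+G(\xi,v)$ for all $\xi\in X$, $v\in U$, where $B\in\mathcal{L}(U,X)$ and $G:X\times U\to X$ is a nonlinear operator satisfying the following conditions: 1. $G(0,v)=0$ for all $v\in U$. 2. For all $r>0$, there exist $K_r>0$ and $\chi_r\in\mathcal{K}$ such that for all $\xi,\zeta\in X$ with $\|\xi\|,\|\zeta\|\le r$ and all $v\in U$, $\|G(\xi,v)-G(\zeta,v)\|\le K_r\|\xi-\zeta\|\,\chi_r(\|v\|_U)$. 3. For all $\tau>0$ and all functions $f\in C([0,\tau],X)$, $g\in L^\infty([0,\tau],U)$, the map $t\mapsto G(f(t),g(t))$ is measurable on $[0,\tau]$. Suppose moreover that there exist $K>0$ and $\chi\in\mathcal{K}$ such that for all $\xi\in X$, $v\in U$, and $t\ge0$, $$\|T(t)G(\xi,v)\|\le\frac{K\|\xi\|\,\chi(\|v\|_U)}{(t+1)^{1/\alpha}} .$$ Then the bilinear system $\Sigma(A,F)$ is polynomially iISS with parameter $\alpha$ for $\mathcal{U}=L^\infty(\mathbb{R}_+,U)$.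
   Context: $\mathcal{L}(U,X)$ denotes the bounded linear operators from $U$ to $X$; $\|\cdot\|$ and $\|\cdot\|_U$ are the norms of $X$ and $U$; $\mathbb{R}_+=[0,\infty)$. The graph norm is $\|x\|_A:=\|x\|+\|Ax\|$, $x\in D(A)$. For real functions, $f(t)=O(g(t))$ as $t\to\infty$ means there are $M>0$, $t_0$ with $f(t)\le Mg(t)$ for $t\ge t_0$. Comparison functions: $\mathcal{K}$ is the set of continuous strictly increasing $\mu:\mathbb{R}_+\to\mathbb{R}_+$ with $\mu(0)=0$; $\mathcal{K}_\infty$ is the set of unbounded $\mu\in\mathcal{K}$; $\mathcal{L}$ is the set of continuous strictly decreasing $\mu:\mathbb{R}_+\to\mathbb{R}_+$ with $\lim_{t\to\infty}\mu(t)=0$; $\mathcal{KL}$ is the set of continuous $\kappa:\mathbb{R}_+\times\mathbb{R}_+\to\mathbb{R}_+$ with $\kappa(\cdot,t)\in\mathcal{K}$ for all $t\ge0$ and $\kappa(r,\cdot)\in\mathcal{L}$ for all $r>0$. A $C_0$-semigroup $(T(t))_{t\ge0}$ on a Banach space with generator $A$ is semi-uniformly stable if it is uniformly bounded and $\|T(t)(I-A)^{-1}\|\to0$ as $t\to\infty$ (it is known that then $\sigma(A)\cap i\mathbb{R}=\emptyset$, so $A^{-1}$ is a bounded operator). It is polynomially stable with parameter $\alpha>0$ if it is semi-uniformly stable and $\|T(t)A^{-1}\|=O(t^{-1/\alpha})$ as $t\to\infty$. The system $\Sigma(A,F)$ is $\dot x(t)=Ax(t)+F(x(t),u(t))$,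 $t\ge0$, $x(0)=x_0\in X$, with inputs $u\in\mathcal{U}=L^\infty(\mathbb{R}_+,U)$. A mild solution on $\mathbb{R}_+$ is $x\in C(\mathbb{R}_+,X)$ with $x(t)=T(t)x_0+\int_0^tT(t-s)F(x(s),u(s))\,\mathrm{d}s$ for all $t\ge0$ (Bochner integral). $\Sigma(A,F)$ is forward complete if for all $x_0\in X$, $u\in\mathcal{U}$ there is a unique mild solution on $\mathbb{R}_+$, denoted $\phi(\cdot,x_0,u)$. $\Sigma(A,F)$ is uniformly globally stable at zero if it is forward complete and there exists $\gamma\in\mathcal{K}_\infty$ such that $\|\phi(t,x_0,0)\|\le\gamma(\|x_0\|)$ for all $x_0\in X$, $t\ge0$. $\Sigma(A,F)$ is polynomially integral input-to-state stable (polynomially iISS) with parameter $\alpha>0$ if it is uniformly globally stable at zero and there exist $\kappa\in\mathcal{KL}$, $\theta\in\mathcal{K}_\infty$, $\mu\in\mathcal{K}$ such that $$\|\phi(t,x_0,u)\|\le\kappa(\|x_0\|_A,t)+\theta\left(\int_0^t\mu(\|u(s)\|_U)\,\mathrm{d}s\right)$$ for all $x_0\in D(A)$, $u\in\mathcal{U}$, $t\ge0$, and $\kappa(r,t)=O(t^{-1/\alpha})$ as $t\to\infty$ for every $r>0$. *)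

(* Defs.v *)
From HB Require Import structures.
From mathcomp Require Import all_boot all_order all_algebra.
From mathcomp Require Import all_classical all_reals all_analysis.

Set Implicit Arguments.
Unset Strict Implicit.
Unset Printing Implicit Defensive.
Import Order.TTheory GRing.Theory Num.Theory.
Import numFieldNormedType.Exports.
Local Open Scope classical_set_scope.
Local Open Scope ring_scope.

(* MathComp-Analysis.  Banach spaces are [completeNormedModType R] with R the
   field of real numbers.  Complex Banach spaces are covered by restriction of
   scalars: the norm, bounded operators, semigroups, generators, the inverses
   of A and I - A, and Bochner integrals below are then unchanged.
   Functions of time are total on R; only their values on [0, +oo[ matter. *)

Section ComparisonFunctions.
Context {R : realType}.
Implicit Types (mu : R -> R) (kappa : R -> R -> R).

(* The values on [0, +oo[ are nonnegative by monotonicity and [mu 0 = 0]. *)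
Definition class_K mu : Prop :=
  [/\ {within `[0, +oo[, continuous mu},
      (forall r s : R, 0 <= r -> r < s -> mu r < mu s) &
      mu 0 = 0].

Definition class_Kinf mu : Prop :=
  class_K mu /\ (forall M : R, exists r, 0 <= r /\ M < mu r).

Definition class_L mu : Prop :=
  [/\ {within `[0, +oo[, continuous mu},
      (forall r : R, 0 <= r -> 0 <= mu r),
      (forall r s : R, 0 <= r -> r < s -> mu s < mu r) &
      mu t @[t --> +oo] --> 0].

Definition class_KL kappa : Prop :=
  [/\ {within [set p : R * R | 0 <= p.1 /\ 0 <= p.2],
         continuous (fun p : R * R => kappa p.1 p.2)},
      (forall t : R, 0 <= t -> class_K (fun r => kappa r t)) &
      (forall r : R, 0 < r -> class_L (fun t => kappa r t))].

Definition bigO_infty (f g : R -> R) : Prop :=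
  exists M t0 : R, 0 < M /\ (forall t : R, t0 <= t -> f t <= M * g t).

End ComparisonFunctions.

Section Bochner.
Context {R : realType} {X : completeNormedModType R}.

Local Notation leb := (@lebesgue_measure R).

(* A presentation \sum_i 1_(E i) x_i of an X-valued simple function. *)
Record simple_repr := SimpleRepr {
  simple_size : nat;
  simple_set : 'I_simple_size -> set R;
  simple_val : 'I_simple_size -> X;
  simple_measurable : forall i, measurable (simple_set i);
  simple_finite : forall i, (leb (simple_set i) < +oo)%E
}.

Definition simple_fun (s : simple_repr) (t : R) : X :=
  \sum_(i < simple_size s) (\1_(simple_set i) t : R) *: simple_val i.

Definition simple_integral (D : set R) (s : simple_repr) : X :=
  \sum_(i < simple_size s) fine (leb (simple_set i `&` D)) *: simple_val i.

(* The sets [simple_set i] are Borel, but because convergence is only required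
   almost everywhere this is strong Lebesgue measurability. *)
Definition strongly_measurable (D : set R) (f : R -> X) : Prop :=
  exists s : nat -> simple_repr,
    {ae leb, forall t, D t -> simple_fun (s n) t @[n --> \oo] --> f t}.

(* [f] is Bochner integrable on [D], with integral [y].  The integrand
   t |-> `|f t - simple_fun (s n) t| is nonnegative and Lebesgue measurable;
   the library integral, a supremum over Borel simple functions, is its
   Lebesgue integral even when it is not Borel measurable. *)
Definition has_bochner_integral (D : set R) (f : R -> X) (y : X) : Prop :=
  exists s : nat -> simple_repr,
    [/\ {ae leb, forall t, D t -> simple_fun (s n) t @[n --> \oo] --> f t},
        (\int[leb]_(t in D) (`|f t - simple_fun (s n) t|)%:E)%E
          @[n --> \oo] --> (0 : \bar R)%E &
        simple_integral D (s n) @[n --> \oo] --> y].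

(* Representatives of the elements of L^oo(D, X). *)
Definition Linfty (D : set R) (f : R -> X) : Prop :=
  strongly_measurable D f /\
  (exists M : R, {ae leb, forall t, D t -> `|f t| <= M}).

End Bochner.

Section Operators.
Context {R : realType}.

Definition bounded_linear (V W : completeNormedModType R) (f : V -> W) : Prop :=
  linear f /\ (exists M : R, forall x, `|f x| <= M * `|x|).

(* Operator norm; meaningful for bounded operators only ([sup] of an unbounded
   set is 0). *)
Definition opnorm (V W : completeNormedModType R) (f : V -> W) : R :=
  sup [set `|f x| | x in [set x | `|x| <= 1]].

Context {X : completeNormedModType R}.
Implicit Type T : R -> X -> X.

Definition C0_semigroup T : Prop :=
  [/\ (forall t : R, 0 <= t -> bounded_linear (T t)),
      (forall x, T 0 x = x),
      (forall (s t : R) x, 0 <= s -> 0 <= t -> T (s + t) x = T s (T t x)) &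
      (forall x, T h x @[h --> 0^'+] --> x)].

Definition gen_dom T : set X :=
  [set x | cvg (h^-1 *: (T h x - x) @[h --> 0^'+])].

(* The generator A; its value is meaningful on [gen_dom T] = D(A) only. *)
Definition gen T (x : X) : X := lim (h^-1 *: (T h x - x) @[h --> 0^'+]).

Definition graph_norm T (x : X) : R := `|x| + `|gen T x|.

(* [S] is the bounded inverse of the operator [L] with domain [D]; such an [S]
   is unique. *)
Definition bounded_inverse (D : set X) (L S : X -> X) : Prop :=
  [/\ bounded_linear S,
      (forall x, D (S x) /\ L (S x) = x) &
      (forall x, D x -> S (L x) = x)].

Definition semi_uniformly_stable T : Prop :=
  [/\ C0_semigroup T,
      (exists M : R, forall t : R, 0 <= t -> opnorm (T t) <= M) &
      (exists S, bounded_inverse (gen_dom T) (fun x => x - gen T x) S /\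
         opnorm (T t \o S) @[t --> +oo] --> 0)].

Definition polynomially_stable (alpha : R) T : Prop :=
  semi_uniformly_stable T /\
  (exists S, bounded_inverse (gen_dom T) (gen T) S /\
     bigO_infty (fun t => opnorm (T t \o S)) (fun t => t `^ (- alpha^-1))).

End Operators.

(* The system Sigma(A, F), given by the semigroup T generated by A. *)
Section System.
Context {R : realType} {X U : completeNormedModType R}.
Variables (T : R -> X -> X) (F : X -> U -> X).

Local Notation leb := (@lebesgue_measure R).

Definition input (u : R -> U) : Prop := Linfty `[0, +oo[ u.

Definition mild_solution (x0 : X) (u : R -> U) (x : R -> X) : Prop :=
  {within `[0, +oo[, continuous x} /\
  (forall t : R, 0 <= t -> exists y : X,
     has_bochner_integral `[0, t] (fun s => T (t - s) (F (x s) (u s))) y /\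
     x t = T t x0 + y).

Definition forward_complete : Prop :=
  forall (x0 : X) (u : R -> U), input u ->
  exists x, mild_solution x0 u x /\
    (forall x', mild_solution x0 u x' -> forall t : R, 0 <= t -> x' t = x t).

Definition uniformly_globally_stable_at_zero : Prop :=
  forward_complete /\
  (exists gamma : R -> R, class_Kinf gamma /\
    forall (x0 : X) (phi : R -> X), mild_solution x0 (fun=> 0) phi ->
    forall t : R, 0 <= t -> `|phi t| <= gamma `|x0|).

Definition polynomially_iISS (alpha : R) : Prop :=
  uniformly_globally_stable_at_zero /\
  (exists (kappa : R -> R -> R) (theta mu : R -> R),
    [/\ class_KL kappa, class_Kinf theta, class_K mu,
        (forall (x0 : X) (u : R -> U) (phi : R -> X),
           gen_dom T x0 -> input u -> mild_solution x0 u phi ->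
           forall t : R, 0 <= t ->
           `|phi t| <= kappa (graph_norm T x0) t
                       + theta (\int[leb]_(s in `[0, t]) mu `|u s|)) &
        (forall r : R, 0 < r ->
           bigO_infty (kappa r) (fun t => t `^ (- alpha^-1)))]).

End System.

(* Main.v *)
Require Import Defs.
From mathcomp Require Import all_boot all_order all_algebra.
From mathcomp Require Import all_classical all_reals all_analysis.
From mathcomp Require Import measurable_realfun.
From mathcomp Require Import ring lra.
Import Order.TTheory GRing.Theory Num.Theory.
Import numFieldNormedType.Exports.
Local Open Scope classical_set_scope.
Local Open Scope ring_scope.

(** Put beta = 1/alpha and let phi be a mild solution with initial value x0 in
D(A) and input u.

_The estimate._  By the variation of constants formula, |phi(t)| is at most the
sum of three terms: C |x0|_A (1+t)^-beta, since x0 = A^-1 (A x0) and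
T(t) A^-1 decays polynomially; M |B| times the integral of |u|; and the
convolution of K |phi| chi(|u|) with (1+t)^-beta, which is what the decay of
T(t) G gives.  Because 1+t <= (1+t-s)(1+s), multiplying by the weight
(1+t)^beta absorbs the convolution kernel: on [0,L] the function
w(t) = (1+t)^beta |phi(t)| satisfies a linear Gronwall inequality with kernel
K chi(|u|) and a constant inhomogeneity (its value at L).  Gronwall and division
by the weight at L lead to

  |phi(L)| <= (z + b m) E,   z = C |x0|_A (1+L)^-beta,   E = exp(2 K m),

where m is the integral over [0,L] of |u| + chi(|u|) ([bilinear_estimate]).
This mixes initial value and input; Young's inequality
z E <= z + z^2 + (E - 1)^2 separates them ([young_gain]), and z + z^2 is a KL
function of |x0|_A and L that decays like L^-beta.

_Forward completeness._  At t = 0 the decay hypothesis reads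
|G(xi,v)| <= K |xi| chi(|v|).  With this linear growth, Picard iterates never
leave the ball of radius a exp(b t), for suitable a and b, so the Lipschitz
constant of G on one ball serves for all of them on a bounded time interval, and
they converge on the whole half-line at once ([duhamel_exists]).  Uniqueness is
Gronwall's inequality ([duhamel_unique]).  The same bound on G, with chi(0) = 0,
shows that F(.,0) = 0, so that solutions without input are orbits of T; this is
stability at zero.

_Integration._  A strongly measurable function agrees almost everywhere with a
function that is everywhere a limit of simple functions ([simple_limit]).  The
norms of the latter are Borel, so existence of the Bochner integral and the
bound of its norm follow from dominated convergence
([has_bochner_integral_exists], [has_bochner_integral_dist_le]); passing between
the two functions uses that integrals of nonnegative functions are monotone
almost everywhere, which holds also for integrands that are Borel only up to a
null set ([ae_le_lower_integral]).  The integrand T(t-s) f(s) is of this kind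
because s can be frozen on a grid of mesh 1/n inside T(t-s)
([simple_limit_convolution]). *)

(** * Lower integrals and simple functions *)

Section LowerIntegral.
Import HBNNSimple.

(** The integral of a nonnegative function is a supremum of integrals of simple
functions below it, and a simple function can be set to zero on a null set
without changing its integral.  In this form the lemma applies to integrands that
are Borel only up to a null set, such as the norm of a strongly measurable
function. *)
Lemma ae_le_lower_integral {d} {T : measurableType d} {R : realType}
  (mu : {measure set T -> \bar R}) (D : set T) (f g : T -> \bar R) :
  (forall x, D x -> (0 <= f x)%E) -> (forall x, D x -> (0 <= g x)%E) ->
  {ae mu, forall x, D x -> (f x <= g x)%E} ->
  (\int[mu]_(x in D) f x <= \int[mu]_(x in D) g x)%E.
Proof.
move=> f0 g0 [N [mN N0 fg]].
rewrite [leLHS]integral_mkcond [leRHS]integral_mkcond.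
rewrite !ge0_integralTE; last 2 first.
- by move=> x; rewrite /patch; case: ifPn => // /[!inE]; exact: g0.
- by move=> x; rewrite /patch; case: ifPn => // /[!inE]; exact: f0.
apply: ge_ereal_sup => _ [h /= hf <-].
have mNC : measurable (~` N) by exact: measurableC.
apply: ereal_sup_ubound => /=.
exists (proj_nnsfun h mNC) => [x /=|].
  rewrite /patch/= mindicE.
  have := hf x; rewrite /patch.
  case: (boolP (x \in ~` N)) => [/[!inE] xN|_ _]; last first.
    rewrite mulr0; case: ifPn => // /[!inE]; exact: g0.
  rewrite mulr1; case: ifPn => // /[!inE] Dx hx.
  apply: (le_trans hx); apply: contrapT => nfg; apply: xN; apply: fg => /=.
  by move=> /(_ Dx).
rewrite -!integralT_nnsfun; apply: ge0_ae_eq_integral => //.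
- exact/measurable_EFinP.
- exact/measurable_EFinP.
- by move=> x _; rewrite lee_fin.
- by move=> x _; rewrite lee_fin.
exists N; split => // x /= hx; apply: contrapT => xN; apply: hx => _.
by rewrite /= mindicE mem_set// mulr1.
Qed.
End LowerIntegral.

Lemma ae_eq_lower_integral {d} {T : measurableType d} {R : realType}
  (mu : {measure set T -> \bar R}) (D : set T) (f g : T -> \bar R) :
  (forall x, D x -> (0 <= f x)%E) -> (forall x, D x -> (0 <= g x)%E) ->
  {ae mu, forall x, D x -> f x = g x} ->
  (\int[mu]_(x in D) f x = \int[mu]_(x in D) g x)%E.
Proof.
move=> f0 g0 fg; apply/eqP; rewrite eq_le; apply/andP; split.
  by apply: ae_le_lower_integral => //; apply: filterS fg => x h /h ->.
by apply: ae_le_lower_integral => //; apply: filterS fg => x h /h ->.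
Qed.

Lemma lebesgue_measure_mono {R : realType} (A B : set R) :
  measurable A -> measurable B -> A `<=` B ->
  (lebesgue_measure A <= lebesgue_measure B)%E.
Proof. by move=> mA mB AB; apply: le_measure; rewrite ?inE. Qed.

Section SimpleFunctions.
Context {R : realType} {X : completeNormedModType R}.
Local Notation leb := (@lebesgue_measure R).
Implicit Types (s : @simple_repr R X) (D A : set R).

Lemma simple_of_family {I : finType} (E : I -> set R) (x : I -> X) :
  (forall i, measurable (E i)) -> (forall i, (leb (E i) < +oo)%E) ->
  {s : @simple_repr R X |
    (forall t, simple_fun s t = \sum_i (\1_(E i) t : R) *: x i) &
    (forall D, simple_integral D s = \sum_i fine (leb (E i `&` D)) *: x i)}.
Proof.
move=> mE fE.
exists (@SimpleRepr R X #|I| (fun k => E (enum_val k)) (fun k => x (enum_val k))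
  (fun k => mE _) (fun k => fE _)) => [t|D].
  by rewrite /simple_fun/= [RHS](reindex _ (onW_bij _ (@enum_val_bij I)))/=.
by rewrite /simple_integral/= [RHS](reindex _ (onW_bij _ (@enum_val_bij I)))/=.
Qed.

Lemma simple_lincomb s (c : R) s' : {s'' : @simple_repr R X |
  (forall t, simple_fun s'' t = simple_fun s t + c *: simple_fun s' t) &
  (forall D, simple_integral D s'' =
             simple_integral D s + c *: simple_integral D s')}.
Proof.
pose E (i : 'I_(simple_size s) + 'I_(simple_size s')) : set R :=
  match i with inl i => simple_set i | inr i => simple_set i end.
pose x (i : 'I_(simple_size s) + 'I_(simple_size s')) : X :=
  match i with inl i => simple_val i | inr i => c *: simple_val i end.
have mE i : measurable (E i) by case: i => i; exact: simple_measurable.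
have fE i : (leb (E i) < +oo)%E by case: i => i; exact: simple_finite.
have [s'' h1 h2] := simple_of_family E x mE fE.
exists s'' => [t|D]; rewrite ?h1 ?h2 big_sumType/=; congr (_ + _);
  by rewrite scaler_sumr; apply: eq_bigr => i _; rewrite !scalerA mulrC.
Qed.

Lemma simple_restrict A s : measurable A -> {s' : @simple_repr R X |
  (forall t, simple_fun s' t = (\1_A t : R) *: simple_fun s t) &
  (forall D, simple_integral D s' = simple_integral (A `&` D) s)}.
Proof.
move=> mA.
have mE (i : 'I_(simple_size s)) : measurable (simple_set i `&` A).
  by apply: measurableI => //; exact: simple_measurable.
have fE (i : 'I_(simple_size s)) : (leb (simple_set i `&` A) < +oo)%E.
  apply: le_lt_trans (simple_finite i); apply: lebesgue_measure_mono => //.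
  exact: simple_measurable.
have [s' h1 h2] := simple_of_family _ (@simple_val _ _ s) mE fE.
exists s' => [t|D]; rewrite ?h1 ?h2.
  rewrite /simple_fun scaler_sumr; apply: eq_bigr => i _.
  by rewrite scalerA indicI mulrC.
by apply: eq_bigr => i _; rewrite setIA.
Qed.

Lemma linear_sum_ext (V W : completeNormedModType R) (f : V -> W) : linear f ->
  forall (I : Type) (r : seq I) (c : I -> R) (v : I -> V),
  f (\sum_(i <- r) c i *: v i) = \sum_(i <- r) c i *: f (v i).
Proof.
move=> lf I r c v.
have f0 : f 0 = 0.
  have := lf (-1) 0 0; rewrite scaler0 addr0 scaleN1r addNr; exact.
elim: r => [|i r IH]; first by rewrite !big_nil.
by rewrite !big_cons lf IH.
Qed.

(** An arbitrary [phi] is allowed because the sum takes finitely many values. *)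
Lemma indic_sum_measurable n (E : 'I_n -> set R) (x : 'I_n -> X) (phi : X -> R) D :
  (forall i, measurable (E i)) ->
  measurable_fun D (fun t => phi (\sum_i (\1_(E i) t : R) *: x i)).
Proof.
move=> mE; apply: (@measurable_funS _ _ _ _ setT) => //.
elim: n E x mE phi => [|n IH] E x mE phi.
  by under eq_fun do rewrite big_ord0; exact: measurable_cst.
pose S t := \sum_(i < n) (\1_(E (lift ord0 i)) t : R) *: x (lift ord0 i).
have mS (psi : X -> R) : measurable_fun setT (fun t => psi (S t)).
  exact: (IH (fun i => E (lift ord0 i)) (fun i => x (lift ord0 i)) (fun i => mE _)
    psi).
rewrite (_ : (fun t => _) = (fun t => (\1_(E ord0) t : R) * phi (x ord0 + S t)
   + (1 - (\1_(E ord0) t : R)) * phi (S t))).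
  apply: measurable_funD; apply: measurable_funM.
  - exact: measurable_indic.
  - exact: (mS (fun z => phi (x ord0 + z))).
  - by apply: measurable_funB => //; exact: measurable_indic.
  - exact: mS.
apply/funext => t; rewrite big_ord_recl -/(S t) indicE; case: (_ \in _).
  by rewrite scale1r mul1r subrr mul0r addr0.
by rewrite scale0r add0r mul0r add0r subr0 mul1r.
Qed.

Lemma simple_comp_measurable s (phi : X -> R) D :
  measurable_fun D (fun t => phi (simple_fun s t)).
Proof. by apply: indic_sum_measurable; exact: simple_measurable. Qed.

(** The sets [E i] may overlap.  Induction on their number avoids passing to a
disjoint presentation: splitting [D] along the first set adds its vector to the
constant [c] on one of the two pieces. *)
Lemma norm_sum_measure_le n (E : 'I_n -> set R) (x : 'I_n -> X) D (c : X) :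
  (forall i, measurable (E i)) -> measurable D -> (leb D < +oo)%E ->
  (`|fine (leb D) *: c + \sum_i fine (leb (E i `&` D)) *: x i|%:E <=
   \int[leb]_(t in D) `|c + \sum_i (\1_(E i) t : R) *: x i|%:E)%E.
Proof.
elim: n E x D c => [|n IH] E x D c mE mD fD.
  under eq_integral do rewrite big_ord0 addr0.
  rewrite big_ord0 addr0 integral_cst// normrZ EFinM ger0_norm ?fine_ge0//.
  by rewrite fineK ?ge0_fin_numE// muleC.
pose D1 := D `&` E ord0; pose D2 := D `\` E ord0.
have mD1 : measurable D1 by exact: (measurableI _ _ mD (mE ord0)).
have mD2 : measurable D2 by exact: (measurableD mD (mE ord0)).
have fD1 : (leb D1 < +oo)%E.
  by apply: le_lt_trans fD; apply: lebesgue_measure_mono => //; exact: subIsetl.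
have fD2 : (leb D2 < +oo)%E.
  by apply: le_lt_trans fD; apply: lebesgue_measure_mono => //; exact: subDsetl.
have DU : D = D1 `|` D2 by rewrite /D1 /D2 setUIDK.
have D12 : [disjoint D1 & D2].
  by apply/disj_setPS => t [[_ h1] [_ h2]].
have fineDU A : measurable A ->
    fine (leb (A `&` D)) = fine (leb (A `&` D1)) + fine (leb (A `&` D2)).
  move=> mA; rewrite DU setIUr measureU//; last 3 first.
  - exact: measurableI.
  - exact: measurableI.
  - by apply/seteqP; split => // t [[_ [_ h1]] [_ [_ h2]]].
  rewrite fineD// ge0_fin_numE//.
    by apply: le_lt_trans fD1; apply: lebesgue_measure_mono => //; exact: measurableI.
  by apply: le_lt_trans fD2; apply: lebesgue_measure_mono => //; exact: measurableI.
rewrite DU (@ge0_integral_setU _ _ _ leb D1 D2 mD1 mD2); last 3 first.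
- apply/measurable_EFinP.
  exact: (@indic_sum_measurable _ E x (fun z => `|c + z|) _ mE).
- by move=> t _; rewrite lee_fin.
- exact: D12.
rewrite -DU.
set S := \sum_(i < n.+1) _.
have -> : fine (leb D) *: c + S =
  (fine (leb D1) *: (c + x ord0) + \sum_(i < n)
     fine (leb (E (lift ord0 i) `&` D1)) *: x (lift ord0 i)) +
  (fine (leb D2) *: c + \sum_(i < n)
     fine (leb (E (lift ord0 i) `&` D2)) *: x (lift ord0 i)).
  rewrite /S big_ord_recl.
  under eq_bigr => i _ do rewrite (fineDU _ (mE (lift ord0 i))) scalerDl.
  rewrite big_split/= (setIC (E ord0)) -/D1.
  have -> : fine (leb D) = fine (leb D1) + fine (leb D2).
    by have := fineDU setT measurableT; rewrite !setTI.
  by rewrite scalerDl scalerDr !addrA; do 2 rewrite [RHS]addrAC; 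
    rewrite -!addrA; congr (_ + _); rewrite addrCA; congr (_ + _); rewrite addrCA.
apply: (@le_trans _ _ (_ + _)%:E); first by rewrite lee_fin; exact: ler_normD.
rewrite EFinD; apply: leeD.
  apply: (le_trans (IH _ _ _ _ (fun i => mE (lift ord0 i)) mD1 fD1)).
  rewrite le_eqVlt; apply/orP; left; apply/eqP; apply: eq_integral => t.
  rewrite inE => -[_ tE]; rewrite big_ord_recl indicE mem_set// scale1r addrA.
  by [].
apply: (le_trans (IH _ _ _ _ (fun i => mE (lift ord0 i)) mD2 fD2)).
rewrite le_eqVlt; apply/orP; left; apply/eqP; apply: eq_integral => t.
rewrite inE => -[_ tE]; rewrite big_ord_recl indicE memNset// scale0r add0r.
by [].
Qed.

Lemma norm_simple_integral_le s D : measurable D -> (leb D < +oo)%E ->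
  (`|simple_integral D s|%:E <= \int[leb]_(t in D) `|simple_fun s t|%:E)%E.
Proof.
move=> mD fD.
have := @norm_sum_measure_le _ (@simple_set _ _ s) (@simple_val _ _ s) D 0
  (@simple_measurable _ _ s) mD fD.
by rewrite scaler0 add0r; under eq_integral do rewrite add0r.
Qed.

End SimpleFunctions.

(** * Everywhere limits of simple functions *)

Lemma cvg_of_norm_le {R : realType} {X : normedModType R} (u : nat -> X) (l : X)
  (a : nat -> R) :
  a n @[n --> \oo] --> 0 -> (forall n, `|u n - l| <= a n) ->
  u n @[n --> \oo] --> l.
Proof.
move=> a0 ua; apply/cvgrPdist_lt => e e0.
move/cvgrPdist_lt/(_ e e0): a0; apply: filterS => n.
rewrite sub0r normrN distrC => h.
apply: le_lt_trans (ua n) _; apply: le_lt_trans h; exact: ler_norm.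
Qed.

(** Both the integrals of approximating simple functions and the Picard iterates
come with estimates of this symmetric form. *)
Lemma cvg_of_cauchy_le {R : realType} {X : completeNormedModType R}
  (u : nat -> X) (a : nat -> R) :
  a n @[n --> \oo] --> 0 -> (forall n m, `|u n - u m| <= a n + a m) ->
  cvg (u n @[n --> \oo]).
Proof.
move=> a0 ua; apply: cauchy_cvg; apply: cauchy_exP => e e0.
have e20 : 0 < e / 2 by rewrite divr_gt0.
move/cvgrPdist_lt/(_ _ e20): a0 => -[N _ hN].
exists (u N); exists N => // m /= Nm.
rewrite -ball_normE /=.
apply: le_lt_trans (ua N m) _; rewrite (splitr e).
apply: ltrD.
  have := hN N (leqnn N); rewrite sub0r normrN; exact/le_lt_trans/ler_norm.
have := hN m Nm; rewrite sub0r normrN; exact/le_lt_trans/ler_norm.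
Qed.

Section Bochner.
Context {R : realType} {X : completeNormedModType R}.
Local Notation leb := (@lebesgue_measure R).
Implicit Types (f g : R -> X) (D A : set R).

Lemma ae_imp (P Q : R -> Prop) : {ae leb, forall t, P t} ->
  (forall t, P t -> Q t) -> {ae leb, forall t, Q t}.
Proof.
move=> [N [mN N0 h]] PQ; exists N; split => // t nQ.
by apply: h => /= p; apply: nQ; exact: PQ.
Qed.

Lemma ae_imp2 (P P' Q : R -> Prop) : {ae leb, forall t, P t} ->
  {ae leb, forall t, P' t} -> (forall t, P t -> P' t -> Q t) ->
  {ae leb, forall t, Q t}.
Proof.
move=> [N [mN N0 h]] [N' [mN' N'0 h']] PQ; exists (N `|` N'); split => //.
- exact: measurableU.
- by rewrite null_set_setU.
move=> t nQ; apply: contrapT => nN; apply: nQ; apply: PQ; apply: contrapT => np.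
  by apply: nN; left; exact: h.
by apply: nN; right; exact: h'.
Qed.

(** Convergence is required at every point, so that norms of such functions are
Borel and not merely almost everywhere equal to a Borel function. *)
Definition simple_limit f : Prop :=
  exists s : nat -> @simple_repr R X,
    forall t, simple_fun (s n) t @[n --> \oo] --> f t.

Lemma simple_limit_norm_measurable f D :
  simple_limit f -> measurable_fun D (fun t => `|f t|).
Proof.
move=> [s sf]; apply: (@measurable_fun_cvg _ _ _ D (fun n t => `|simple_fun (s n) t|)).
  by move=> n; exact: simple_comp_measurable.
by move=> t _; apply: cvg_norm; exact: sf.
Qed.

Lemma simple_limit_lincomb f (c : R) g :
  simple_limit f -> simple_limit g -> simple_limit (fun t => f t + c *: g t).
Proof.
move=> [s sf] [s' sg].
have /choice[s'' h] : forall n, exists s'', forall t, simple_fun s'' t =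
    simple_fun (s n) t + c *: simple_fun (s' n) t.
  by move=> n; have [s'' h _] := simple_lincomb (s n) c (s' n); exists s''.
exists s'' => t; under eq_fun do rewrite h.
apply: cvgD; first exact: sf.
by apply: cvgZr; exact: sg.
Qed.

Lemma simple_limit_sub f g :
  simple_limit f -> simple_limit g -> simple_limit (fun t => f t - g t).
Proof.
move=> sf sg; have := simple_limit_lincomb f (-1) g sf sg.
by under eq_fun do rewrite scaleN1r.
Qed.

(** Outside a Borel null set the approximating simple functions converge and the
property [Q] holds; cutting them off there makes them converge everywhere. *)
Lemma strongly_measurable_version D f (Q : R -> Prop) : measurable D ->
  strongly_measurable D f -> {ae leb, forall t, D t -> Q t} ->
  exists A, [/\ measurable A, (forall t, A t -> D t /\ Q t),
    {ae leb, forall t, D t -> A t} &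
    simple_limit (fun t => (\1_A t : R) *: f t)].
Proof.
move=> mD [s [N [mN N0 sf]]] [N' [mN' N'0 hQ]].
have NN'0 : leb (N `|` N') = 0%E by rewrite null_set_setU.
exists (D `\` (N `|` N')); split.
- by apply: measurableD => //; exact: measurableU.
- move=> t [Dt nN]; split => //; apply: contrapT => nQ; apply: nN; right.
  by apply: hQ => /= /(_ Dt).
- exists (N `|` N'); split => //; first exact: measurableU.
  by move=> t /= h; apply: contrapT => nN; apply: h.
have mA : measurable (D `\` (N `|` N')).
  by apply: measurableD => //; exact: measurableU.
have /choice[s' h] : forall n, exists s', forall t, simple_fun s' t =
    (\1_(D `\` (N `|` N')) t : R) *: simple_fun (s n) t.
  by move=> n; have [s' h _] := simple_restrict _ (s n) mA; exists s'.
exists s' => t; under eq_fun do rewrite h.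
rewrite indicE; case: (boolP (t \in _)) => [|_].
  rewrite inE => -[Dt nN]; apply: cvgZr; apply: contrapT => nc; apply: nN; left.
  by apply: sf => /= /(_ Dt).
by under eq_fun do rewrite scale0r; rewrite scale0r; exact: cvg_cst.
Qed.

(** Dominated convergence with a constant majorant. *)
Lemma integral_bounded_cvg0 D (h : nat -> R -> R) (C : R) :
  measurable D -> (leb D < +oo)%E ->
  (forall n, measurable_fun D (h n)) ->
  (forall n t, D t -> 0 <= h n t <= C) ->
  {ae leb, forall t, D t -> h n t @[n --> \oo] --> 0} ->
  (\int[leb]_(t in D) (h n t)%:E)%E @[n --> \oo] --> 0%E.
Proof.
move=> mD fD mh hC h0.
have iC : leb.-integrable D (EFin \o cst C).
  apply: measurable_bounded_integrable => //.
  exists `|C|; split; first exact: num_real.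
  by move=> M CM t _ /=; exact: ltW.
have [] := @dominated_convergence _ _ _ leb D mD (fun n t => (h n t)%:E)
  (cst 0%E) (EFin \o cst C) _ _ _ iC.
- by move=> n; apply/measurable_EFinP; exact: (mh n).
- exact: measurable_cst.
- apply: ae_imp h0 _ => t h0 Dt.
  by apply: cvg_EFin; [exact: nearW|exact: h0].
- apply: aeW => t n Dt /=; rewrite lee_fin.
  by have /andP[h1 h2] := hC n t Dt; rewrite ger0_norm.
by move=> _ _; rewrite integral0.
Qed.

End Bochner.

(** * The Bochner integral *)

Section BochnerIntegral.
Context {R : realType} {X : completeNormedModType R}.
Local Notation leb := (@lebesgue_measure R).
Implicit Types (f g : R -> X) (D A : set R).

Lemma simple_limit_simple_fun (s : @simple_repr R X) : simple_limit (simple_fun s).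
Proof. by exists (fun=> s) => t; exact: cvg_cst. Qed.

(** With [f = g] this is the Cauchy estimate behind existence of the integral;
with [f] and [g] different, its limit is the estimate of their integrals. *)
Lemma simple_integral_dist_le D f g (s s' : @simple_repr R X) :
  measurable D -> (leb D < +oo)%E -> simple_limit f -> simple_limit g ->
  (`|simple_integral D s - simple_integral D s'|%:E <=
   \int[leb]_(t in D) `|f t - g t|%:E +
   (\int[leb]_(t in D) `|f t - simple_fun s t|%:E +
    \int[leb]_(t in D) `|g t - simple_fun s' t|%:E))%E.
Proof.
move=> mD fD lf lg.
have [s'' h1 h2] := simple_lincomb s (-1) s'.
rewrite -scaleN1r -h2.
apply: (le_trans (norm_simple_integral_le s'' D mD fD)).
have m1 : measurable_fun D (fun t => `|f t - g t|%:E).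
  apply/measurable_EFinP.
  exact: (simple_limit_norm_measurable _ D (simple_limit_sub _ _ lf lg)).
have m2 : measurable_fun D (fun t => `|f t - simple_fun s t|%:E).
  apply/measurable_EFinP; apply: (simple_limit_norm_measurable _ D).
  by apply: simple_limit_sub => //; exact: simple_limit_simple_fun.
have m3 : measurable_fun D (fun t => `|g t - simple_fun s' t|%:E).
  apply/measurable_EFinP; apply: (simple_limit_norm_measurable _ D).
  by apply: simple_limit_sub => //; exact: simple_limit_simple_fun.
have m23 : measurable_fun D (fun t => `|f t - simple_fun s t|%:E +
  `|g t - simple_fun s' t|%:E)%E by exact: emeasurable_funD m2 m3.
rewrite -(@ge0_integralD _ _ _ leb D mD _ _ _ m2 _ m3); last 2 first.
- by move=> t _; rewrite lee_fin.
- by move=> t _; rewrite lee_fin.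
rewrite -(@ge0_integralD _ _ _ leb D mD _ _ _ m1 _ m23); last 2 first.
- by move=> t _; rewrite lee_fin.
- by move=> t _; rewrite -EFinD lee_fin addr_ge0.
apply: ae_le_lower_integral.
- by move=> t _; rewrite lee_fin.
- by move=> t _; rewrite -!EFinD lee_fin !addr_ge0.
apply: aeW => t _; rewrite -!EFinD lee_fin h1 scaleN1r.
have -> : simple_fun s t - simple_fun s' t =
    (f t - g t) + ((simple_fun s t - f t) + (g t - simple_fun s' t)).
  by rewrite [RHS]addrCA subrKA subrKA.
apply: (le_trans (ler_normD _ _)); rewrite lerD2l.
by apply: (le_trans (ler_normD _ _)); rewrite distrC.
Qed.

Lemma has_bochner_integral_ae D f g y :
  {ae leb, forall t, D t -> f t = g t} ->
  has_bochner_integral D f y -> has_bochner_integral D g y.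
Proof.
move=> fg [s [h1 h2 h3]]; exists s; split => //.
  by apply: ae_imp2 fg h1 _ => t fg h1 Dt; rewrite -fg//; exact: h1.
rewrite (_ : (fun n => _) = (fun n => \int[leb]_(t in D)
    (`|f t - simple_fun (s n) t|)%:E)%E)//.
apply/funext => n; apply: ae_eq_lower_integral.
- by move=> t _; rewrite lee_fin.
- by move=> t _; rewrite lee_fin.
- by apply: ae_imp fg _ => t fg Dt; rewrite fg.
Qed.

Lemma has_bochner_integral_strongly_measurable D f y :
  has_bochner_integral D f y -> strongly_measurable D f.
Proof. by move=> [s [h _ _]]; exists s. Qed.

Lemma strongly_measurable_simple_limit D f : measurable D ->
  strongly_measurable D f -> exists g, simple_limit g /\
    {ae leb, forall t, D t -> f t = g t}.
Proof.
move=> mD sf.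
have [A [_ _ h1 h2]] := strongly_measurable_version D f (fun=> True) mD sf
  (aeW _ (fun t _ => I)).
exists (fun t => (\1_A t : R) *: f t); split => //.
by apply: ae_imp h1 _ => t At /At tA; rewrite indicE mem_set// scale1r.
Qed.

(** Pass to the limit in [simple_integral_dist_le], after replacing [f] and [g] by
limits of simple functions; neither side notices the replacement. *)
Lemma has_bochner_integral_dist_le D f g y z : measurable D -> (leb D < +oo)%E ->
  has_bochner_integral D f y -> has_bochner_integral D g z ->
  (`|y - z|%:E <= \int[leb]_(t in D) `|f t - g t|%:E)%E.
Proof.
move=> mD fD hf hg.
have [f' [lf ff']] := strongly_measurable_simple_limit D f mD
  (has_bochner_integral_strongly_measurable _ _ _ hf).
have [g' [lg gg']] := strongly_measurable_simple_limit D g mD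
  (has_bochner_integral_strongly_measurable _ _ _ hg).
rewrite (@ae_eq_lower_integral _ _ _ leb D _ (fun t => `|f' t - g' t|%:E)); last 3 first.
- by move=> t _; rewrite lee_fin.
- by move=> t _; rewrite lee_fin.
- by apply: ae_imp2 ff' gg' _ => t h1 h2 Dt; rewrite h1// h2.
move: hf => /(has_bochner_integral_ae _ _ _ _ ff') [s [_ hs Is]].
move: hg => /(has_bochner_integral_ae _ _ _ _ gg') [s' [_ hs' Is']].
set c := (\int[leb]_(t in D) _)%E.
pose a n := (\int[leb]_(t in D) `|f' t - simple_fun (s n) t|%:E)%E.
pose b n := (\int[leb]_(t in D) `|g' t - simple_fun (s' n) t|%:E)%E.
have : `|simple_integral D (s n) - simple_integral D (s' n)|%:E @[n --> \oo] -->
    `|y - z|%:E.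
  apply: cvg_EFin; first exact: nearW.
  by apply: cvg_norm; apply: cvgB.
have : (c + (a n + b n))%E @[n --> \oo] --> (c + (0 + 0))%E.
  apply: cvgeD; last by apply: cvgeD.
    by rewrite adde0 fin_num_adde_defl.
  exact: cvg_cst.
rewrite !adde0 => /[swap] /lee_cvg_to /[apply]; apply.
by apply: nearW => n; exact: simple_integral_dist_le.
Qed.

Lemma has_bochner_integral0 D : has_bochner_integral D (fun=> (0 : X)) 0.
Proof.
have [s s0' s0''] := @simple_of_family R X 'I_0 (fun=> set0) (fun=> 0)
  (fun=> @measurable0 _ _) (fun i => False_rect _ (notF (ltn_ord i))).
have s0 t : simple_fun s t = 0 by rewrite s0' big_ord0.
exists (fun=> s); split.
- apply: aeW => t _; under eq_fun do rewrite s0; exact: cvg_cst.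
- rewrite (_ : (fun n => _) = fun=> 0%E); first exact: cvg_cst.
  by apply/funext => n; apply: integral0_eq => t _; rewrite s0 subr0 normr0.
- by under eq_fun do rewrite s0'' big_ord0; exact: cvg_cst.
Qed.

(** Simple functions converging to [f] need not be dominated.  Setting them to zero
where their norm exceeds [M + 1] makes them so without affecting the limit,
since the approximants of a value of norm at most [M] are eventually kept. *)
Lemma has_bochner_integral_exists D f M : measurable D -> (leb D < +oo)%E ->
  simple_limit f -> (forall t, `|f t| <= M) ->
  exists y, has_bochner_integral D f y.
Proof.
move=> mD fD lf fM; have [s sf] := lf.
pose A n := [set t | `|simple_fun (s n) t| <= M + 1].
have mA n : measurable (A n).
  have := simple_comp_measurable (s n) (fun x => `|x|) setT measurableT
    [set` `]-oo, M + 1]] (measurable_itv _).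
  by rewrite setTI; congr measurable; apply/seteqP; split => t /=; rewrite in_itv.
have /choice[s' h] : forall n, exists s', forall t, simple_fun s' t =
    (\1_(A n) t : R) *: simple_fun (s n) t.
  by move=> n; have [s' h _] := simple_restrict _ (s n) (mA n); exists s'.
have M0 : 0 <= M by apply: le_trans (fM 0).
have s'M n t : `|simple_fun (s' n) t| <= M + 1.
  rewrite h indicE; case: (boolP (t \in _)) => [/[!inE]|_].
    by rewrite scale1r.
  by rewrite scale0r normr0 addr_ge0.
have s'f t : simple_fun (s' n) t @[n --> \oo] --> f t.
  have : `|simple_fun (s n) t| @[n --> \oo] --> `|f t| by apply: cvg_norm; exact: sf.
  move=> /cvgrPdist_lt/(_ 1 ltr01) nA.
  apply: cvg_trans (sf t); apply: near_eq_cvg; apply: filterS nA => n.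
  move=> /ltW; rewrite ler_distl => /andP[h1 _].
  rewrite h indicE mem_set ?scale1r// /A /=.
  by apply: (@le_trans _ _ (`|f t| + 1)); rewrite ?lerD2r// -lerBlDr.
have J0 : (\int[leb]_(t in D) `|f t - simple_fun (s' n) t|%:E)%E @[n --> \oo] --> 0%E.
  apply: (integral_bounded_cvg0 D (fun n t => `|f t - simple_fun (s' n) t|)
    (M + (M + 1))) => //.
  - move=> n; apply: simple_limit_norm_measurable.
    by apply: simple_limit_sub => //; exact: simple_limit_simple_fun.
  - move=> n t _; rewrite normr_ge0/=.
    by apply: (le_trans (ler_normB _ _)); exact: lerD.
  - apply: aeW => t _; rewrite -(@normr0 _ X) -(subrr (f t)).
    by apply: cvg_norm; apply: cvgB; [exact: cvg_cst|exact: s'f].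
have [Jf fJ0] := (fine_cvgP _ _).1 J0.
have : cvg (simple_integral D (s' n) @[n --> \oo]).
  have Jfin n : (\int[leb]_(t in D) `|f t - simple_fun (s' n) t|%:E)%E
      \is a fin_num.
    rewrite ge0_fin_numE; last by apply: integral_ge0 => t _; rewrite lee_fin.
    apply: (@le_lt_trans _ _ (\int[leb]_(t in D) (M + (M + 1))%:E)%E).
      apply: ae_le_lower_integral.
      - by move=> t _; rewrite lee_fin.
      - by move=> t _; rewrite lee_fin !addr_ge0.
      - apply: aeW => t _; rewrite lee_fin.
        by apply: (le_trans (ler_normB _ _)); exact: lerD.
    by rewrite integral_cst// lte_mul_pinfty// lee_fin !addr_ge0.
  apply: (cvg_of_cauchy_le _ _ fJ0) => n m; rewrite -lee_fin EFinD /= !fineK//.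
  have := simple_integral_dist_le D f f (s' n) (s' m) mD fD lf lf.
  rewrite [X in (_ <= X + _)%E]integral0_eq ?add0e//.
  by move=> t _; rewrite subrr normr0.
move=> Ic; exists (lim (simple_integral D (s' n) @[n --> \oo])), s'; split => //.
by apply: aeW => t _; exact: s'f.
Qed.

(** This brings integrals over different intervals to a common one, where they can
be compared by [has_bochner_integral_dist_le]. *)
Lemma has_bochner_integral_extend D A f y : measurable A -> A `<=` D ->
  has_bochner_integral A f y ->
  has_bochner_integral D (fun t => (\1_A t : R) *: f t) y.
Proof.
move=> mA AD [s [h1 h2 h3]].
have /choice[s' h] : forall n, exists s',
   (forall t, simple_fun s' t = (\1_A t : R) *: simple_fun (s n) t) /\
   (forall E, simple_integral E s' = simple_integral (A `&` E) (s n)).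
  by move=> n; have [s' H1 H2] := simple_restrict _ (s n) mA; exists s'.
exists s'; split.
- apply: ae_imp h1 _ => t h1 Dt; under eq_fun do rewrite (h _).1.
  rewrite indicE; case: (boolP (t \in _)) => [/[!inE] At|_].
    by apply: cvgZr; exact: h1.
  by under eq_fun do rewrite scale0r; rewrite scale0r; exact: cvg_cst.
- rewrite (_ : (fun n => _) = (fun n => \int[leb]_(t in A)
    (`|f t - simple_fun (s n) t|)%:E)%E)//.
  apply/funext => n; rewrite [LHS]integral_mkcond [RHS]integral_mkcond.
  apply: eq_integral => t _; rewrite /patch (h n).1 -scalerBr indicE.
  case: (boolP (t \in A)) => [tA|_]; last by rewrite scale0r normr0; case: ifP.
  by rewrite scale1r ifT// inE; apply: AD; rewrite inE in tA.
- by under eq_fun do rewrite (h _).2 (setIidl AD).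
Qed.

End BochnerIntegral.

(** * Operator norms and semigroups *)

Lemma linear_sub {R : realType} {V W : completeNormedModType R} (f : V -> W) x y :
  linear f -> f (x - y) = f x - f y.
Proof. by move=> lf; rewrite -scaleN1r addrC lf scaleN1r addrC. Qed.

Lemma linear_zero {R : realType} {V W : completeNormedModType R} (f : V -> W) :
  linear f -> f 0 = 0.
Proof. by move=> lf; rewrite -(subrr 0) linear_sub// subrr. Qed.

Lemma norm_le_opnorm {R : realType} {V W : completeNormedModType R} (f : V -> W) x :
  bounded_linear f -> `|x| <= 1 -> `|f x| <= opnorm f.
Proof.
move=> [_ [M fM]] x1; apply: ub_le_sup; last by exists x.
exists (`|M|) => _ [z /= z1 <-]; apply: le_trans (fM z) _.
apply: (@le_trans _ _ (`|M| * `|z|)).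
  by apply: ler_wpM2r => //; exact: ler_norm.
by rewrite -[leRHS]mulr1; exact: ler_wpM2l.
Qed.

Lemma opnorm_ge0 {R : realType} {V W : completeNormedModType R} (f : V -> W) :
  bounded_linear f -> 0 <= opnorm f.
Proof.
move=> bf; apply: le_trans (norm_le_opnorm f 0 bf _); first exact: normr_ge0.
by rewrite normr0.
Qed.

Lemma opnorm_le {R : realType} {V W : completeNormedModType R} (f : V -> W) x :
  bounded_linear f -> `|f x| <= opnorm f * `|x|.
Proof.
move=> bf; have [lf _] := bf.
have [->|x0] := eqVneq x 0; first by rewrite linear_zero// !normr0 mulr0.
have nx : 0 < `|x| by rewrite normr_gt0.
rewrite -ler_pdivrMr//.
have fZ c : f (c *: x) = c *: f x.
  by have := lf c x 0; rewrite !addr0 linear_zero// addr0.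
rewrite mulrC -[`|x|^-1]ger0_norm ?invr_ge0// -normrZ -fZ.
apply: norm_le_opnorm => //.
by rewrite normrZ ger0_norm ?invr_ge0// mulVf// gt_eqF.
Qed.

(** Sequential continuity is the form delivered by dominated convergence.  The rate
[n.+1%:R^-1] keeps the test sequences in one bounded interval. *)
Lemma within_continuous_of_seq {R : realType} {X : normedModType R} (D : set R)
  (x : R -> X) :
  (forall (u : nat -> R) t, D t -> (forall n, D (u n)) ->
     (forall n, `|u n - t| < n.+1%:R^-1) -> u n @[n --> \oo] --> t ->
     x (u n) @[n --> \oo] --> x t) ->
  {within D, continuous x}.
Proof.
move=> xs; apply/subspace_continuousP => t Dt; apply/cvgrPdist_lt => e e0.
apply: contrapT => nn.
have /choice[u hu] : forall n : nat, exists r, [/\ D r, `|r - t| < n.+1%:R^-1 &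
    e <= `|x t - x r|].
  move=> n; apply: contrapT => nr; apply: nn.
  apply/nbhs_ballP; exists (n.+1%:R^-1) => /=; first by rewrite invr_gt0.
  move=> r; rewrite -ball_normE /= distrC => rt Dr.
  rewrite ltNge; apply/negP => er; apply: nr.
  by exists r.
have ut : u n @[n --> \oo] --> t.
  apply: (@cvg_of_norm_le _ R^o u t (fun n => n.+1%:R^-1)).
    exact: cvg_harmonic.
  by move=> n; have [_ /ltW] := hu n.
have := xs u t Dt (fun n => let: And3 h _ _ := hu n in h)
  (fun n => let: And3 _ h _ := hu n in h) ut.
move/cvgrPdist_lt/(_ _ e0) => -[N _ /(_ N (leqnn N))] /=.
by have [_ _] := hu N; rewrite leNgt => /negP.
Qed.

Section Semigroup.
Context {R : realType} {X : completeNormedModType R} (T : R -> X -> X)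
  (cT : C0_semigroup T) (M : R)
  (TM : forall t x, 0 <= t -> `|T t x| <= M * `|x|).
Local Notation leb := (@lebesgue_measure R).

Lemma semigroup_linear t : 0 <= t -> linear (T t).
Proof. by move=> t0; have [h _ _ _] := cT; have [] := h t t0. Qed.

Lemma semigroup_sub t x y : 0 <= t -> T t (x - y) = T t x - T t y.
Proof. by move=> t0; apply: linear_sub; exact: semigroup_linear. Qed.

Lemma semigroup_near0 z e : 0 < e ->
  exists2 d, 0 < d & forall h, 0 <= h -> h < d -> `|T h z - z| < e.
Proof.
move=> e0; have [_ T0 _ /(_ z)/cvgrPdist_lt/(_ e e0)] := cT.
move=> -[d /= d0 hd]; exists d => // h; rewrite le_eqVlt => /predU1P[<-|h0] hltd.
  by rewrite T0 subrr normr0.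
rewrite distrC; apply: hd => //=.
by rewrite /= sub0r normrN gtr0_norm.
Qed.

(** The semigroup law reduces the increment of an orbit to one at time zero, for
both signs of [t - s]; strong continuity on the right is thus enough for
continuity. *)
Lemma semigroup_increment s t z : 0 <= s -> 0 <= t ->
  `|T t z - T s z| <= M * `|T `|t - s| z - z|.
Proof.
wlog st : s t / s <= t.
  move=> H s0 t0; have [|/ltW] := leP s t; first by move=> /H; apply.
  by move=> /H/(_ t0 s0); rewrite distrC (distrC s).
move=> s0 t0; have [_ _ TD _] := cT.
have -> : T t z = T s (T (t - s) z) by rewrite -TD ?subr_ge0// addrC subrK.
rewrite [`|t - s|]ger0_norm ?subr_ge0//.
by rewrite -semigroup_sub//; exact: TM.
Qed.

Lemma semigroup_cvg (t : R) (u : nat -> R) z : 0 <= t -> (forall n, 0 <= u n) ->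
  u n @[n --> \oo] --> t -> T (u n) z @[n --> \oo] --> T t z.
Proof.
move=> t0 u0 ut.
apply: (cvg_of_norm_le _ _ (fun n => M * `|T `|u n - t| z - z|)) => [|n]; last first.
  exact: semigroup_increment.
rewrite -(mulr0 M); apply: cvgMl_tmp; apply/cvgrPdist_lt => e e0.
have [d d0 hd] := semigroup_near0 z e e0.
move/cvgrPdist_lt/(_ d d0): ut; apply: filterS => n; rewrite distrC => und.
by rewrite sub0r normrN normr_id; exact: hd.
Qed.

Lemma orbit_continuous z : {within `[0, +oo[, continuous (fun t => T t z)}.
Proof.
apply: within_continuous_of_seq => u t; rewrite /= in_itv/= andbT => t0 u0 _ ut.
apply: semigroup_cvg => // n; have := u0 n.
by rewrite /= in_itv/= andbT.
Qed.

(** If the simple functions [S n] converge to [f], then replacing [t - s] by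
[t - k / n.+1] on the interval where [k] is the integer part of [s * n.+1] turns
[T (t - s) (S n s)] into a simple function.  The error is at most
[M] times the distance from [S n s] to [f s], plus an increment of the orbit of
the fixed vector [f s]. *)
Lemma simple_limit_convolution f t : simple_limit f -> 0 <= t ->
  simple_limit (fun s => (\1_(`[0, t]) s : R) *: T (t - s) (f s)).
Proof.
move=> [S Sf] t0.
pose I (n k : nat) : set R := [set s | k%:R <= s * n.+1%:R < k.+1%:R].
have mI n k : measurable (I n k).
  rewrite (_ : I n k = `[k%:R / n.+1%:R, k.+1%:R / n.+1%:R[%classic)//.
  by apply/seteqP; split => s /=; rewrite in_itv/= ler_pdivrMr// ltr_pdivlMr.
pose K n := (Num.truncn (t * n.+1%:R)).+1.
have /choice[S' hS'] : forall n, exists s' : @simple_repr R X, forall s,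
    simple_fun s' s = \sum_(k < K n) (\1_(I n k `&` `[0, t]) s : R) *:
      T (t - k%:R / n.+1%:R) (simple_fun (S n) s).
  move=> n.
  pose E (p : 'I_(K n) * 'I_(simple_size (S n))) : set R :=
    simple_set p.2 `&` (I n p.1 `&` `[0, t]).
  have mE p : measurable (E p).
    by apply: measurableI; [exact: simple_measurable|apply: measurableI].
  have fE p : (leb (E p) < +oo)%E.
    apply: le_lt_trans (simple_finite p.2).
    apply: lebesgue_measure_mono => //; first exact: simple_measurable.
    exact: subIsetl.
  have [s' h _] := simple_of_family E (fun p => T (t - (p.1 : nat)%:R / n.+1%:R)
     (simple_val p.2)) mE fE.
  exists s' => s; rewrite h.
  rewrite -(pair_bigA _ (fun (k : 'I_(K n)) (i : 'I_(simple_size (S n))) =>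
    (\1_(E (k, i)) s : R) *: T (t - k%:R / n.+1%:R) (simple_val i)))/=.
  apply: eq_bigr => k _; rewrite /E/= [in RHS]indicE.
  case: (boolP (s \in _)) => [/[!inE] sI|sI]; last first.
    rewrite scale0r big1// => i _.
    by rewrite indicE in_setI (negbTE sI) andbF scale0r.
  rewrite scale1r /simple_fun linear_sum_ext; last first.
    apply: semigroup_linear; have [/andP[ks _] +] := sI.
    rewrite /= in_itv/= => /andP[_ st]; rewrite subr_ge0 ler_pdivrMr//.
    by apply: (le_trans ks); rewrite ler_pM2r.
  apply: eq_bigr => i _; congr (_ *: _).
  by rewrite !indicE in_setI (mem_set sI) andbT.
exists S' => s; under eq_fun do rewrite hS'.
rewrite indicE; case: (boolP (s \in _)) => [/[!inE] st|st]; last first.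
  rewrite scale0r (_ : (fun n => _) = fun=> 0); first exact: cvg_cst.
  apply/funext => n; rewrite big1// => k _.
  by rewrite indicE in_setI (negbTE st) andbF scale0r.
have := st; rewrite /= in_itv/= => /andP[s0 sltt].
pose k n := Num.truncn (s * n.+1%:R).
have kK n : (k n < K n)%N by rewrite /k /K ltnS le_truncn// ler_pM2r.
have ks n : (k n)%:R / n.+1%:R <= s < (k n)%:R / n.+1%:R + n.+1%:R^-1.
  rewrite ler_pdivrMr// -{2}(mul1r n.+1%:R^-1) -mulrDl ltr_pdivlMr//.
  by rewrite natr1 truncn_itv// mulr_ge0.
have sumE n : \sum_(k < K n) (\1_(I n k `&` `[0, t]) s : R) *:
      T (t - k%:R / n.+1%:R) (simple_fun (S n) s) =
    T (t - (k n)%:R / n.+1%:R) (simple_fun (S n) s).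
  rewrite (bigD1 (Ordinal (kK n)))//= big1 ?addr0.
    rewrite indicE mem_set ?scale1r//; split => //.
    by rewrite /I/= truncn_itv// mulr_ge0.
  move=> j jk; rewrite indicE memNset ?scale0r// => -[+ _].
  rewrite /I/= -truncn_eq ?mulr_ge0// => /eqP jE.
  by move/eqP: jk; apply; apply: val_inj => /=; rewrite -jE.
under eq_fun do rewrite sumE.
rewrite scale1r.
(* The error of freezing time: first in the simple function, then in the orbit. *)
pose a n := M * `|simple_fun (S n) s - f s| +
  `|T (t - (k n)%:R / n.+1%:R) (f s) - T (t - s) (f s)|.
have tk n : 0 <= t - (k n)%:R / n.+1%:R.
  by rewrite subr_ge0; have /andP[h _] := ks n; exact: le_trans h _.
apply: (cvg_of_norm_le _ _ a) => [|n]; last first.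
  rewrite -(subrKA (T (t - (k n)%:R / n.+1%:R) (f s))).
  apply: le_trans (ler_normD _ _) _; rewrite lerD2r -semigroup_sub//.
  exact: TM.
rewrite -(addr0 0); apply: cvgD.
  rewrite -(mulr0 M); apply: cvgMl_tmp; rewrite -(@normr0 _ X) -(subrr (f s)).
  by apply: cvg_norm; apply: cvgB; [exact: Sf|exact: cvg_cst].
rewrite -(@normr0 _ X) -(subrr (T (t - s) (f s))).
apply: cvg_norm; apply: cvgB; last exact: cvg_cst.
apply: semigroup_cvg => //; first by rewrite subr_ge0.
apply: cvgB; first exact: cvg_cst.
apply: (cvg_of_norm_le _ _ (fun n => n.+1%:R^-1)); first exact: cvg_harmonic.
move=> n; have /andP[h1 h2] := ks n.
by rewrite ler0_norm ?subr_le0// opprB lerBlDl ltW.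
Qed.

End Semigroup.

(** * Convolution with a semigroup *)

Section StrongMeasurability.
Context {R : realType}.
Local Notation leb := (@lebesgue_measure R).

Lemma bounded_simple_limit_version {X : completeNormedModType R} D (f : R -> X)
  (C : R) : measurable D -> 0 <= C ->
  strongly_measurable D f -> {ae leb, forall t, D t -> `|f t| <= C} ->
  exists g, [/\ simple_limit g, (forall t, `|g t| <= C) &
    {ae leb, forall t, D t -> f t = g t}].
Proof.
move=> mD C0 sf fC.
have [A [mA hA AD lA]] := strongly_measurable_version D f _ mD sf fC.
exists (fun t => (\1_A t : R) *: f t); split => //.
- move=> t; rewrite indicE; case: (boolP (t \in A)) => [/[!inE] /hA[_]|_].
    by rewrite scale1r.
  by rewrite scale0r normr0.
- by apply: ae_imp AD _ => t At /At tA; rewrite indicE mem_set// scale1r.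
Qed.

Lemma strongly_measurable_subset {X : completeNormedModType R} (D A : set R)
  (f : R -> X) :
  A `<=` D -> strongly_measurable D f -> strongly_measurable A f.
Proof.
by move=> AD [s hs]; exists s; apply: ae_imp hs _ => t hs /AD; exact: hs.
Qed.

Lemma ae_subset (D A : set R) (P : R -> Prop) : A `<=` D ->
  {ae leb, forall t, D t -> P t} -> {ae leb, forall t, A t -> P t}.
Proof. by move=> AD h; apply: ae_imp h _ => t h /AD; exact: h. Qed.

Lemma strongly_measurable_add {X : completeNormedModType R} D (f g : R -> X) :
  strongly_measurable D f -> strongly_measurable D g ->
  strongly_measurable D (fun t => f t + g t).
Proof.
move=> [s sf] [s' sg].
have /choice[s'' h] : forall n, exists s'', forall t, simple_fun s'' t =
    simple_fun (s n) t + 1 *: simple_fun (s' n) t.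
  by move=> n; have [s'' h _] := simple_lincomb (s n) 1 (s' n); exists s''.
exists s''; apply: ae_imp2 sf sg _ => t sf sg Dt.
under eq_fun do rewrite h scale1r.
by apply: cvgD; [exact: sf|exact: sg].
Qed.

Lemma strongly_measurable_bounded_linear {U X : completeNormedModType R}
  (B : U -> X) D (u : R -> U) :
  bounded_linear B -> strongly_measurable D u ->
  strongly_measurable D (fun t => B (u t)).
Proof.
move=> [lB [M BM]] [s su].
have /choice[s' h] : forall n, exists s' : @simple_repr R X, forall t,
    simple_fun s' t = B (simple_fun (s n) t).
  move=> n; have [s' h _] := simple_of_family (@simple_set _ _ (s n))
    (fun i => B (simple_val i)) (@simple_measurable _ _ (s n))
    (@simple_finite _ _ (s n)).
  by exists s' => t; rewrite h /simple_fun linear_sum_ext.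
exists s'; apply: ae_imp su _ => t su Dt; under eq_fun do rewrite h.
apply: (cvg_of_norm_le _ _ (fun n => M * `|simple_fun (s n) t - u t|)); last first.
  by move=> n; rewrite -linear_sub.
rewrite -(mulr0 M); apply: cvgMl_tmp; rewrite -(@normr0 _ U) -(subrr (u t)).
by apply: cvg_norm; apply: cvgB; [exact: su|exact: cvg_cst].
Qed.

Lemma lebesgue_measure_segment (t : R) : 0 <= t ->
  leb `[0, t] = t%:E.
Proof.
move=> t0; rewrite lebesgue_measure_itv/= lte_fin.
case: ltP => [_|t0']; first by rewrite sube0.
by congr (_%:E); apply/eqP; rewrite eq_le t0 t0'.
Qed.

Lemma lebesgue_measure_segment_lty (t : R) : 0 <= t -> (leb `[0%R, t] < +oo)%E.
Proof. by move=> t0; rewrite lebesgue_measure_segment// ltry. Qed.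

End StrongMeasurability.

Section Convolution.
Context {R : realType} {X : completeNormedModType R} (T : R -> X -> X)
  (cT : C0_semigroup T) (M : R) (M0 : 0 <= M)
  (TM : forall t x, 0 <= t -> `|T t x| <= M * `|x|).
Local Notation leb := (@lebesgue_measure R).

Lemma convolution_bounded (f : R -> X) C t s : (forall s, `|f s| <= C) ->
  `|(\1_(`[0, t]) s : R) *: T (t - s) (f s)| <= M * C.
Proof.
move=> fC; rewrite indicE; case: (boolP (s \in _)) => [/[!inE]|_]; last first.
  by rewrite scale0r normr0 mulr_ge0// (le_trans _ (fC 0)).
rewrite /= in_itv/= => /andP[_ st]; rewrite scale1r.
apply: le_trans (TM _ _ _) _; first by rewrite subr_ge0.
exact: ler_wpM2l.
Qed.

Lemma convolution_exists (f : R -> X) C t : 0 <= t -> 0 <= C ->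
  strongly_measurable `[0, t] f ->
  {ae leb, forall s, `[0, t]%classic s -> `|f s| <= C} ->
  exists y, has_bochner_integral `[0, t] (fun s => T (t - s) (f s)) y.
Proof.
move=> t0 C0 sf fC.
have [g [lg gC fg]] := bounded_simple_limit_version _ f C (measurable_itv _) C0 sf fC.
have [y hy] := has_bochner_integral_exists `[0, t]
  (fun s => (\1_(`[0, t]) s : R) *: T (t - s) (g s)) (M * C) (measurable_itv _)
  (lebesgue_measure_segment_lty t t0)
  (simple_limit_convolution T cT M TM g t lg t0)
  (fun s => convolution_bounded g C t s gC).
exists y; apply: has_bochner_integral_ae hy.
by apply: ae_imp fg _ => s fg st; rewrite indicE mem_set// scale1r fg.
Qed.

(** Extended by zero to [[0, L]], the integrands for the times [u n] converge to the
integrand for [t] at every [s] other than [t]. *)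
Lemma convolution_seq_continuous (f : R -> X) C L (y : R -> X) (u : nat -> R) t :
  0 <= L -> 0 <= C -> strongly_measurable `[0, L] f ->
  {ae leb, forall s, `[0, L]%classic s -> `|f s| <= C} ->
  (forall t, 0 <= t <= L ->
     has_bochner_integral `[0, t] (fun s => T (t - s) (f s)) (y t)) ->
  0 <= t <= L -> (forall n, 0 <= u n <= L) -> u n @[n --> \oo] --> t ->
  y (u n) @[n --> \oo] --> y t.
Proof.
move=> L0 C0 sf fC hy tL uL ut.
have [g [lg gC fg]] := bounded_simple_limit_version _ f C (measurable_itv _) C0 sf fC.
pose h r s := (\1_(`[0, r]) s : R) *: T (r - s) (g s).
have lh r : 0 <= r -> simple_limit (h r).
  by move=> r0; exact: (simple_limit_convolution T cT M TM g r lg r0).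
have sub r : r <= L -> `[0, r]%classic `<=` `[0, L]%classic.
  by move=> rL s; rewrite /= !in_itv/= => /andP[-> /le_trans]; apply.
have hyh r : 0 <= r <= L -> has_bochner_integral `[0, L] (h r) (y r).
  move=> rL; have := hy r rL; case/andP: rL => r0 rL.
  move=> /(has_bochner_integral_extend `[0, L] _ _ _ (measurable_itv _) (sub r rL)).
  apply: has_bochner_integral_ae.
  apply: ae_imp fg _ => s fg sL; rewrite /h.
  by rewrite fg.
pose a n := fine (\int[leb]_(s in `[0%R, L]) (`|h (u n) s - h t s|)%:E)%E.
have t0 : 0 <= t by have /andP[] := tL.
have u0 n : 0 <= u n by have /andP[] := uL n.
have int0 : (\int[leb]_(s in `[0%R, L]) (`|h (u n) s - h t s|)%:E)%E
    @[n --> \oo] --> 0%E.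
  apply: (integral_bounded_cvg0 _ (fun n s => `|h (u n) s - h t s|)
    (M * C + M * C)) => //.
  - exact: lebesgue_measure_segment_lty.
  - move=> n; apply: simple_limit_norm_measurable.
    by apply: simple_limit_sub; exact: lh.
  - move=> n s _; rewrite normr_ge0/=; apply: (le_trans (ler_normB _ _)).
    by apply: lerD; exact: convolution_bounded.
  exists [set t]; split; [exact: measurable_set1|exact: lebesgue_measure_set1|].
  move=> s /= ns; apply: contrapT => st; apply: ns => _.
  rewrite -(@normr0 _ X) -(subrr (h t s)).
  apply: cvg_norm; apply: cvgB; last exact: cvg_cst.
  have [s0|s0] := ltP s 0.
    have h0 r : h r s = 0.
      rewrite /h indicE memNset ?scale0r//= in_itv/= => /andP[].
      by rewrite leNgt s0.
    by under eq_fun do rewrite h0; rewrite h0; exact: cvg_cst.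
  have [tls|slt] := leP t s.
    have ts : t < s by rewrite lt_neqAle tls andbT; apply/eqP => /esym.
    have h0 r : r < s -> h r s = 0.
      move=> rs; rewrite /h indicE memNset ?scale0r//= in_itv/= => /andP[_].
      by rewrite leNgt rs.
    rewrite (h0 t)//; apply: (@cvg_trans _ (0 @[n --> \oo])); last exact: cvg_cst.
    apply: near_eq_cvg.
    have [N _ hN] := cvgr_lt t ut s ts; exists N => // n /hN /= uns.
    by rewrite h0.
  have hE r : s <= r -> h r s = T (r - s) (g s).
    by move=> sr; rewrite /h indicE mem_set ?scale1r//= in_itv/= s0 sr.
  rewrite hE; last exact: ltW.
  (* The absolute value keeps the times nonnegative for all [n]; eventually it does
     nothing, since [s < u n]. *)
  pose v n := T `|u n - s| (g s).
  have vc : v n @[n --> \oo] --> T (t - s) (g s).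
    apply: (semigroup_cvg T cT M TM) => //.
      by rewrite subr_ge0 ltW.
    rewrite -[X in _ --> X]ger0_norm; last by rewrite subr_ge0 ltW.
    by apply: (@cvg_norm _ R^o); apply: cvgB => //; exact: cvg_cst.
  apply: cvg_trans vc; apply: near_eq_cvg.
  have [N _ hN] := cvgr_gt t ut s slt; exists N => // n /hN /= sun.
  by rewrite hE ?ltW// /v ger0_norm// subr_ge0 ltW.
have [fin a0] := (fine_cvgP _ _).1 int0.
apply/cvgrPdist_lt => e e0.
have [N1 _ h1] := (cvgrPdist_lt _ _).1 a0 e e0.
have [N2 _ h2] := fin.
exists (maxn N1 N2) => // n; rewrite /= geq_max => /andP[/h1 /= + /h2 /= finn].
rewrite sub0r normrN => /(le_lt_trans (ler_norm _)).
apply: le_lt_trans; rewrite -lee_fin fineK// distrC.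
apply: has_bochner_integral_dist_le => //.
- exact: lebesgue_measure_segment_lty.
- exact: hyh.
- exact: hyh.
Qed.

Lemma convolution_continuous (f : R -> X) (C : R -> R) (y : R -> X) :
  (forall L, 0 <= L -> [/\ 0 <= C L, strongly_measurable `[0, L] f &
    {ae leb, forall s, `[0, L]%classic s -> `|f s| <= C L}]) ->
  (forall t, 0 <= t ->
     has_bochner_integral `[0, t] (fun s => T (t - s) (f s)) (y t)) ->
  {within `[0, +oo[, continuous y}.
Proof.
move=> hf hy; apply: within_continuous_of_seq => u t.
rewrite /= in_itv/= andbT => t0 u0 unt ut.
have L0 : 0 <= t + 1 by rewrite addr_ge0.
have [C0 sf fC] := hf _ L0.
apply: (convolution_seq_continuous f (C (t + 1)) (t + 1)) => //.
- by move=> s /andP[s0 _]; exact: hy.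
- by rewrite t0 lerDl/=.
- move=> n; have := u0 n; rewrite /= in_itv/= andbT => -> /=.
  have := unt n; rewrite ltr_distl => /andP[_ /ltW/le_trans]; apply.
  by rewrite lerD2l invf_le1// ler1n.
Qed.

End Convolution.

(** * Gronwall's inequality *)

Section Gronwall.
Context {R : realType}.
Local Notation leb := (@lebesgue_measure R).

(** On a partition with increments [d] of [Q] at most 1/2, the hypothesis gives
[W b * (1 - d) <= W a], and [1 <= (1 - d) * expR (2 * d)]; multiplying over the
partition yields the exponential.  The factor 2 is the price for not
differentiating [W] and [Q], which are only absolutely continuous in the
application. *)
Lemma discrete_gronwall (W Q : R -> R) (kappa L : R) : 0 <= kappa ->
  (forall t, 0 <= t <= L -> 0 <= W t) ->
  (forall a b, 0 <= a -> a <= b -> b <= L ->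
     W b - W a <= W b * (Q b - Q a) /\ 0 <= Q b - Q a <= kappa * (b - a)) ->
  forall t, 0 <= t <= L -> W t <= W 0 * expR (2 * (Q t - Q 0)).
Proof.
move=> k0 W0 H t /andP[t0 tL].
(* Steps of length [t / N] have increments of [Q] at most [kappa * t / N <= 1/2]. *)
pose N := (Num.truncn (2 * kappa * t)).+1.
have N0 : 0 < N%:R :> R by rewrite ltr0n.
have hN : 2 * kappa * t <= N%:R.
  have := @truncn_itv _ (2 * kappa * t); rewrite !mulr_ge0// => /(_ isT) /andP[_].
  exact: ltW.
pose p (i : nat) := i%:R * (t / N%:R).
have tN0 : 0 <= t / N%:R by rewrite divr_ge0// ltW.
have p0 i : 0 <= p i by rewrite mulr_ge0.
have pt i : (i <= N)%N -> p i <= t.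
  move=> iN; rewrite /p mulrCA ler_piMr// ler_pdivrMr// mul1r ler_nat.
  by [].
suff : forall i, (i <= N)%N -> W (p i) <= W 0 * expR (2 * (Q (p i) - Q 0)).
  move=> /(_ N (leqnn N)); rewrite /p mulrCA divff ?mulr1//.
  by rewrite gt_eqF.
elim=> [|i IH] iN; first by rewrite /p mul0r subrr mulr0 expR0 mulr1.
have pp : p i <= p i.+1 by rewrite ler_wpM2r// ler_nat.
have [h1 /andP[d0 dk]] := H (p i) (p i.+1) (p0 i) pp (le_trans (pt _ iN) tL).
have Wp : 0 <= W (p i.+1) by apply: W0; rewrite p0 (le_trans (pt _ iN)).
set d := Q (p i.+1) - Q (p i) in h1 d0 dk.
have d2 : d <= 2^-1.
  apply: le_trans dk _; rewrite /p -mulrBl -natrB// subSnn mul1r.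
  by rewrite mulrA ler_pdivrMr//; lra.
have e2 : 1 + 2 * d <= expR (2 * d) by exact: expR_ge1Dx.
have -> : 2 * (Q (p i.+1) - Q 0) = 2 * (Q (p i) - Q 0) + 2 * d.
  by rewrite /d; ring.
rewrite expRD mulrA.
apply: (@le_trans _ _ (W (p i) * expR (2 * d))); last first.
  by apply: ler_wpM2r; [exact: expR_ge0|exact: IH (ltnW iN)].
have h3 : W (p i.+1) * (1 - d) <= W (p i) by lra.
apply: (@le_trans _ _ (W (p i.+1) * (1 - d) * expR (2 * d))); last first.
  by apply: ler_wpM2r => //; exact: expR_ge0.
rewrite -mulrA ler_peMr//.
apply: (@le_trans _ _ ((1 - d) * (1 + 2 * d))); first by nra.
by apply: ler_wpM2l => //; lra.
Qed.

Lemma bounded_integrable_segment (g : R -> R) (L C : R) : 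
  measurable_fun `[0, L] g -> (forall t, 0 <= t <= L -> `|g t| <= C) ->
  leb.-integrable `[0, L] (EFin \o g).
Proof.
move=> mg gC; apply: measurable_bounded_integrable => //.
  have [L0|L0] := leP 0 L; first exact: lebesgue_measure_segment_lty.
  by rewrite set_itv_ge ?measure0// bnd_simp -ltNge.
exists C; split; first exact: num_real.
by move=> K CK t /=; rewrite in_itv/= => /gC/le_trans; apply; exact: ltW.
Qed.

Lemma integral_segment_split (g : R -> R) (L a b : R) : 
  leb.-integrable `[0, L] (EFin \o g) -> 0 <= a -> a <= b -> b <= L ->
  \int[leb]_(s in `[0, b]) g s - \int[leb]_(s in `[0, a]) g s =
  \int[leb]_(s in `]a, b]) g s.
Proof.
move=> ig a0 ab bL; apply: Rintegral_itvB; rewrite ?bnd_simp//.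
apply: integrableS ig => //.
by move=> s; rewrite /= !in_itv/= => /andP[-> /le_trans]; apply.
Qed.

Lemma gronwall (k w : R -> R) (kappa C c L : R) :
  measurable_fun `[0, L] k -> measurable_fun `[0, L] w -> 0 <= c ->
  (forall t, 0 <= t <= L -> 0 <= k t <= kappa) ->
  (forall t, 0 <= t <= L -> 0 <= w t <= C) ->
  (forall t, 0 <= t <= L -> w t <= c + \int[leb]_(s in `[0, t]) (k s * w s)) ->
  forall t, 0 <= t <= L -> w t <= c * expR (2 * \int[leb]_(s in `[0, t]) k s).
Proof.
move=> mk mw c0 hk hw H t tL.
have ik : leb.-integrable `[0, L] (EFin \o k).
  apply: (bounded_integrable_segment _ _ kappa) => // s /hk /andP[k0 kK].
  by rewrite ger0_norm.
have ikw : leb.-integrable `[0, L] (EFin \o (fun s => k s * w s)).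
  apply: (bounded_integrable_segment _ _ (kappa * C)).
    exact: measurable_funM.
  move=> s sL; have /andP[k0 kK] := hk s sL; have /andP[w0 wC] := hw s sL.
  by rewrite ger0_norm ?mulr_ge0//; exact: ler_pM.
pose W t := c + \int[leb]_(s in `[0, t]) (k s * w s).
pose Q t := \int[leb]_(s in `[0, t]) k s.
have kw0 s : 0 <= s <= L -> 0 <= k s * w s.
  by move=> sL; rewrite mulr_ge0//; [have /andP[] := hk s sL|have /andP[] := hw s sL].
have W0 r : 0 <= r <= L -> 0 <= W r.
  move=> /andP[r0 rL]; rewrite addr_ge0//; apply: Rintegral_ge0 => s.
  by rewrite /= in_itv/= => /andP[s0 sr]; rewrite kw0// s0 (le_trans sr).
have sub a b : 0 <= a -> b <= L -> `]a, b]%classic `<=` `[0, L]%classic.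
  move=> a0 bL s; rewrite /= !in_itv/= => /andP[/ltW sa sb].
  by rewrite (le_trans a0 sa) (le_trans sb bL).
have Wm a b : 0 <= a -> a <= b -> b <= L -> W a <= W b.
  move=> a0 ab bL; rewrite lerD2l -subr_ge0.
  rewrite (@integral_segment_split (fun s => k s * w s) L)//.
  by apply: Rintegral_ge0 => s /(sub _ _ a0 bL); rewrite /= in_itv/=; exact: kw0.
apply: (le_trans (H t tL)); rewrite -/(W t).
have := @discrete_gronwall W Q kappa L.
have -> : W 0 = c.
  by rewrite /W set_itv1 Rintegral_set1 addr0.
have Q0 : Q 0 = 0 by rewrite /Q set_itv1 Rintegral_set1.
rewrite Q0; move=> /(_ _ W0 _ t tL); rewrite subr0; apply.
  by case/andP: tL => t0 tL; have /andP[k0 /(le_trans k0)] := hk t (introT andP (conj t0 tL)).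
move=> a b a0 ab bL.
have ikS : leb.-integrable `]a, b] (EFin \o k).
  by apply: integrableS ik => //; exact: sub.
have leba : fine (leb `]a, b]) = b - a.
  rewrite lebesgue_measure_itv/= lte_fin; case: ltP => [//|ba].
  by apply/esym/eqP; rewrite subr_eq0 eq_le ab ba.
have fin : (leb `]a, b] < +oo)%E.
  by rewrite lebesgue_measure_itv/=; case: ifP => _ //; rewrite -EFinB ltry.
have QE : Q b - Q a = \int[leb]_(s in `]a, b]) k s.
  exact: (@integral_segment_split _ L).
have WE : W b - W a = \int[leb]_(s in `]a, b]) (k s * w s).
  by rewrite /W opprD addrACA subrr add0r; exact: (@integral_segment_split _ L).
split; last first.
  rewrite QE; apply/andP; split.
    apply: Rintegral_ge0 => s /(sub _ _ a0 bL); rewrite /= in_itv/= => /hk.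
    by case/andP.
  rewrite -leba -Rintegral_cst//; apply: le_Rintegral => //.
    apply: measurable_bounded_integrable => //.
    exists `|kappa|; split; first exact: num_real.
    by move=> K CK s _ /=; exact: ltW.
  by move=> s /(sub _ _ a0 bL); rewrite /= in_itv/= => /hk/andP[].
rewrite WE QE mulrC -RintegralZr//; apply: le_Rintegral => //.
- by apply: integrableS ikw => //; exact: sub.
- rewrite (_ : EFin \o _ = fun s => ((EFin \o k) s * (W b)%:E)%E)//.
  exact: integrableZr.
move=> s sab; have sL : 0 <= s <= L by have := sub _ _ a0 bL _ sab; rewrite /= in_itv.
apply: ler_wpM2l; first by have /andP[] := hk s sL.
apply: (le_trans (H s sL)); apply: Wm => //; first by case/andP: sL.
by move: sab; rewrite /= in_itv/= => /andP[].
Qed.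

Lemma integral_expR (a b t : R) : 0 < b -> 0 <= t ->
  \int[leb]_(s in `[0, t]) (a * expR (b * s)) = a / b * (expR (b * t) - 1).
Proof.
move=> b0; rewrite le_eqVlt => /predU1P[<-|t0].
  by rewrite set_itv1 Rintegral_set1 mulr0 expR0 subrr mulr0.
pose F s := a / b * expR (b * s).
have dF (s : R) : is_derive s 1 F (a * expR (b * s)).
  rewrite /F; apply: is_derive_eq.
  rewrite /GRing.scale/= mulr1 [in LHS](mulrC (expR _)) mulrA divfK//.
  by rewrite gt_eqF.
have cF : continuous F.
  move=> s; apply: differentiable_continuous; apply/derivable1_diffP.
  exact: ex_derive.
rewrite /Rintegral (@continuous_FTC2 _ _ F)//.
- by rewrite -EFinB/= /F mulr0 expR0 mulrBr.
- apply: continuous_subspaceT => s; apply: cvgMl_tmp.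
  apply: continuous_comp; last exact: continuous_expR.
  by apply: cvgMl_tmp.
- split; [by move=> s _; exact: ex_derive| |].
    by apply: cvg_at_right_filter; exact: cF.
  by apply: cvg_at_left_filter; exact: cF.
- by move=> s _; rewrite derive1E; exact: derive_val.
Qed.
End Gronwall.

(** * Well-posedness of semilinear equations *)

(** The majorant [h] is measurable and bounded, so that its real-valued integral is
the extended one. *)
Lemma has_bochner_integral_dist_le_Rintegral {R : realType}
  {X : completeNormedModType R} (t : R) (f g : R -> X) y z (h : R -> R) C :
  0 <= t -> has_bochner_integral `[0, t] f y -> has_bochner_integral `[0, t] g z ->
  measurable_fun `[0, t] h -> (forall s, 0 <= s <= t -> 0 <= h s <= C) ->
  {ae @lebesgue_measure R, forall s, `[0, t]%classic s -> `|f s - g s| <= h s} ->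
  `|y - z| <= \int[@lebesgue_measure R]_(s in `[0, t]) h s.
Proof.
move=> t0 hf hg mh hC fgh.
have ih : (@lebesgue_measure R).-integrable `[0, t] (EFin \o h).
  apply: (bounded_integrable_segment _ _ C) => // s /hC /andP[h0 hC'].
  by rewrite ger0_norm.
rewrite -lee_fin /Rintegral fineK; last first.
  apply: integrable_fin_num => //.
apply: le_trans (has_bochner_integral_dist_le _ f g y z _ _ hf hg) _ => //.
  exact: lebesgue_measure_segment_lty.
apply: ae_le_lower_integral.
- by move=> s _; rewrite lee_fin.
- by move=> s; rewrite /= in_itv/= lee_fin => /hC/andP[].
- by apply: ae_imp fgh _ => s h1 /h1; rewrite lee_fin.
Qed.

Lemma has_bochner_integral_norm_le_Rintegral {R : realType}
  {X : completeNormedModType R} (t : R) (f : R -> X) y (h : R -> R) C :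
  0 <= t -> has_bochner_integral `[0, t] f y ->
  measurable_fun `[0, t] h -> (forall s, 0 <= s <= t -> 0 <= h s <= C) ->
  {ae @lebesgue_measure R, forall s, `[0, t]%classic s -> `|f s| <= h s} ->
  `|y| <= \int[@lebesgue_measure R]_(s in `[0, t]) h s.
Proof.
move=> t0 hf mh hC fh; rewrite -(subr0 y).
apply: (has_bochner_integral_dist_le_Rintegral t f (fun=> 0) _ _ h C) => //.
  exact: has_bochner_integral0.
by apply: ae_imp fh _ => s; rewrite subr0.
Qed.

Lemma within_continuous_seq {R : realType} {X : normedModType R} (D : set R)
  (x : R -> X) (u : nat -> R) t : {within D, continuous x} -> D t ->
  (forall n, D (u n)) -> u n @[n --> \oo] --> t -> x (u n) @[n --> \oo] --> x t.
Proof.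
move=> /subspace_continuousP cx Dt Du ut; have := cx t Dt.
apply: cvg_trans => A /= => -[e e0 eA].
have [N _ hN] := (cvgrPdist_lt _ _).1 ut e e0.
by exists N => // n /hN/= un; apply: eA.
Qed.

Lemma within_continuous_norm {R : realType} {X : normedModType R} (D : set R)
  (x : R -> X) : {within D, continuous x} ->
  {within D, continuous (fun t => `|x t|)}.
Proof. by move=> cx t; apply: (@cvg_norm _ X); exact: cx. Qed.

Lemma within_continuous_add {R : realType} {X : normedModType R} (D : set R)
  (x y : R -> X) : {within D, continuous x} -> {within D, continuous y} ->
  {within D, continuous (fun t => x t + y t)}.
Proof. by move=> cx cy t; apply: cvgD; [exact: cx|exact: cy]. Qed.

Lemma within_continuous_sub {R : realType} {X : normedModType R} (D : set R)
  (x y : R -> X) : {within D, continuous x} -> {within D, continuous y} ->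
  {within D, continuous (fun t => x t - y t)}.
Proof. by move=> cx cy t; apply: cvgB; [exact: cx|exact: cy]. Qed.

Lemma segment_subset_half_line {R : realType} (L : R) :
  `[0, L]%classic `<=` `[0, +oo[%classic.
Proof. by move=> t; rewrite /= !in_itv/= andbT => /andP[]. Qed.

Lemma within_continuous_norm_bounded {R : realType} {X : normedModType R}
  (x : R -> X) (L : R) : {within `[0, +oo[, continuous x} -> 0 <= L ->
  exists2 r, 0 < r & forall t, 0 <= t <= L -> `|x t| <= r.
Proof.
move=> cx L0.
have := within_continuous_norm _ _ (continuous_subspaceW
  (segment_subset_half_line L) cx).
move=> /(EVT_max L0)[c _ hc]; exists (`|x c| + 1).
  by rewrite ltr_pwDr.
by move=> t tL; rewrite (le_trans (hc t _)) ?in_itv//= lerDl.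
Qed.

Lemma within_continuous_norm_measurable {R : realType} {X : normedModType R}
  (x : R -> X) (L : R) : {within `[0, +oo[, continuous x} ->
  measurable_fun `[0, L] (fun t => `|x t|).
Proof.
move=> cx; apply: subspace_continuous_measurable_fun => //.
apply: within_continuous_norm; apply: continuous_subspaceW cx.
exact: segment_subset_half_line.
Qed.

(** The equation x' = A x + f(t, x) for a field [f] of linear growth that is
Lipschitz on balls; for the control system, [f s xi] is [F xi (u s)]. *)
Section WellPosed.
Context {R : realType} {X : completeNormedModType R} (T : R -> X -> X)
  (cT : C0_semigroup T) (M : R) (M0 : 0 <= M)
  (TM : forall t x, 0 <= t -> `|T t x| <= M * `|x|).
Local Notation leb := (@lebesgue_measure R).
Local Notation "'Rp'" := (`[0%R, +oo[%classic : set R).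

Context (f : R -> X -> X) (c0 c1 : R) (c0_ge0 : 0 <= c0) (c1_ge0 : 0 <= c1)
  (f_meas : forall x : R -> X, {within Rp, continuous x} ->
    forall L, 0 <= L -> strongly_measurable `[0, L] (fun s => f s (x s)))
  (f_growth : {ae leb, forall s, Rp s -> forall xi, `|f s xi| <= c0 + c1 * `|xi|})
  (f_lip : forall r, 0 < r -> exists2 l, 0 <= l & {ae leb, forall s, Rp s ->
     forall xi zeta, `|xi| <= r -> `|zeta| <= r ->
     `|f s xi - f s zeta| <= l * `|xi - zeta|}).

(** [x'] is the image of [x] under the Picard map, stated as a relation since the
integral is one; [duhamel x0 x x] is the mild equation. *)
Definition duhamel (x0 : X) (x x' : R -> X) : Prop := forall t, 0 <= t ->
  exists y, has_bochner_integral `[0, t] (fun s => T (t - s) (f s (x s))) y /\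
    x' t = T t x0 + y.

Lemma duhamel_bounded_source (x : R -> X) L r : 
  (forall t, 0 <= t <= L -> `|x t| <= r) ->
  {ae leb, forall s, `[0, L]%classic s -> `|f s (x s)| <= c0 + c1 * r}.
Proof.
move=> xr; apply: ae_imp f_growth _ => s fs sL.
apply: (le_trans (fs (segment_subset_half_line L _ sL) _)).
by rewrite lerD2l ler_wpM2l// xr//; move: sL; rewrite /= in_itv.
Qed.

Lemma duhamel_dist_le (x0 : X) (x z x' z' : R -> X) (L r l : R) (h : R -> R) C :
  0 <= l ->
  {ae leb, forall s, Rp s -> forall xi zeta, `|xi| <= r -> `|zeta| <= r ->
     `|f s xi - f s zeta| <= l * `|xi - zeta|} ->
  (forall t, 0 <= t <= L -> `|x t| <= r) ->
  (forall t, 0 <= t <= L -> `|z t| <= r) ->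
  measurable_fun `[0, L] h ->
  (forall t, 0 <= t <= L -> h t <= C) ->
  (forall t, 0 <= t <= L -> `|x t - z t| <= h t) ->
  duhamel x0 x x' -> duhamel x0 z z' ->
  forall t, 0 <= t <= L ->
  `|x' t - z' t| <= \int[leb]_(s in `[0, t]) (M * l * h s).
Proof.
move=> l0 fl xr zr mh hC xzh dx dz t /andP[t0 tL].
have [y [hy ->]] := dx t t0; have [y' [hy' ->]] := dz t t0.
rewrite opprD addrACA subrr add0r.
have sub : `[0, t]%classic `<=` `[0, L]%classic.
  by move=> s; rewrite /= !in_itv/= => /andP[-> /le_trans]; apply.
apply: (has_bochner_integral_dist_le_Rintegral t _ _ _ _ _ (M * l * C) t0 hy hy').
- by apply: measurable_funM => //; apply: measurable_funS mh.
- move=> s /andP[s0 st]; have sL : 0 <= s <= L by rewrite s0 (le_trans st).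
  have h0 : 0 <= h s by apply: le_trans (xzh s sL).
  by rewrite !mulr_ge0// ler_wpM2l ?mulr_ge0// hC.
apply: ae_imp fl _ => s fl st.
have sL : 0 <= s <= L by have := sub s st; rewrite /= in_itv.
have ts : 0 <= t - s by move: st; rewrite /= in_itv/= subr_ge0 => /andP[].
rewrite -(semigroup_sub T cT)//; apply: (le_trans (TM _ _ ts)).
rewrite -mulrA ler_wpM2l//; apply: (@le_trans _ _ (l * `|x s - z s|)).
  apply: fl; [exact: segment_subset_half_line st|exact: xr|exact: zr].
by rewrite ler_wpM2l// xzh.
Qed.

(** The norm of the difference satisfies a Gronwall inequality with zero constant
term. *)
Lemma duhamel_unique (x0 : X) (x z : R -> X) :
  {within Rp, continuous x} -> {within Rp, continuous z} ->
  duhamel x0 x x -> duhamel x0 z z -> forall t, 0 <= t -> z t = x t.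
Proof.
move=> cx cz dx dz t t0.
have [r1 r10 xr1] := within_continuous_norm_bounded x t cx t0.
have [r2 r20 zr2] := within_continuous_norm_bounded z t cz t0.
have r0 : 0 < r1 + r2 by rewrite addr_gt0.
have [l l0 fl] := f_lip _ r0.
have xr s : 0 <= s <= t -> `|x s| <= r1 + r2.
  by move=> /xr1/le_trans; apply; rewrite lerDl ltW.
have zr s : 0 <= s <= t -> `|z s| <= r1 + r2.
  by move=> /zr2/le_trans; apply; rewrite lerDr ltW.
have mw : measurable_fun `[0, t] (fun s => `|z s - x s|).
  by apply: within_continuous_norm_measurable; exact: within_continuous_sub.
have wC s : 0 <= s <= t -> `|z s - x s| <= (r1 + r2) + (r1 + r2).
  by move=> st; apply: (le_trans (ler_normB _ _)); rewrite lerD ?zr ?xr.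
have := gronwall (fun=> M * l) (fun s => `|z s - x s|) (M * l)
  ((r1 + r2) + (r1 + r2)) 0 t (measurable_cst _) mw (lexx 0).
move=> /(_ _ _ _ t); rewrite t0 lexx mul0r normr_le0 subr_eq0.
move=> H; apply/eqP; apply: H => //.
- by move=> s _; rewrite mulr_ge0/=.
- by move=> s st; rewrite normr_ge0 wC.
move=> s st; rewrite add0r.
apply: (duhamel_dist_le x0 z x z x t (r1 + r2) l _ _ l0 fl zr xr mw wC) => //.
by rewrite lexx.
Qed.

Section Existence.
Context (x0 : X).
Let a := M * `|x0| + 1.
Let b := M * (c0 + c1) + 1.
Let r (t : R) := a * expR (b * t).

Let a1 : 1 <= a. Proof. by rewrite /a lerDr mulr_ge0. Qed.
Let b1 : 1 <= b. Proof. by rewrite /b lerDr mulr_ge0// addr_ge0. Qed.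
Let b0 : 0 < b. Proof. exact: lt_le_trans b1. Qed.
Let a0 : 0 < a. Proof. exact: lt_le_trans a1. Qed.

Let r_ge_a t : 0 <= t -> a <= r t.
Proof.
move=> t0; rewrite /r ler_peMr// ?(ltW a0)// -expR0 ler_expR.
by rewrite mulr_ge0// ltW.
Qed.

Let r_mono s t : s <= t -> r s <= r t.
Proof. by move=> st; rewrite /r ler_pM2l// ler_expR ler_pM2l. Qed.

Let r_gt0 t : 0 < r t. Proof. by rewrite mulr_gt0// expR_gt0. Qed.

Let r_measurable D : measurable_fun D r.
Proof.
apply: (@measurable_funS _ _ _ _ setT) => //.
apply: continuous_measurable_fun => s; apply: cvgMl_tmp.
apply: continuous_comp; last exact: continuous_expR.
by apply: cvgMl_tmp.
Qed.

Let admissible (x : R -> X) :=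
  {within Rp, continuous x} /\ forall t, 0 <= t -> `|x t| <= r t.

Let admissible_le x L : admissible x -> forall t, 0 <= t <= L -> `|x t| <= r L.
Proof. by move=> [_ h] t /andP[/h/le_trans tr /r_mono]; apply: tr. Qed.

(** The ball of radius [r t = a * expR (b * t)] is preserved because [1 <= r] turns
the growth bound [M * (c0 + c1 * r)] into [b * r], and the integral of [b * r]
over [[0, t]] is [r t - a]. *)
Let picard_step x : admissible x ->
  exists x', admissible x' /\ duhamel x0 x x'.
Proof.
move=> ax; have [cx xr] := ax.
have C0 L : 0 <= c0 + c1 * r L by rewrite addr_ge0// mulr_ge0// ltW.
have hy t : exists y, 0 <= t ->
    has_bochner_integral `[0, t] (fun s => T (t - s) (f s (x s))) y.
  have [t0|] := leP 0 t; last by exists 0.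
  have [y hy] := convolution_exists T cT M M0 TM (fun s => f s (x s)) _ t t0
    (C0 t) (f_meas x cx t t0)
    (duhamel_bounded_source x t (r t) (admissible_le x t ax)).
  by exists y.
have [y {}hy] := choice hy.
exists (fun t => T t x0 + y t); split; last first.
  by move=> t t0; exists (y t); split => //; exact: hy.
split.
  apply: within_continuous_add; first exact: (orbit_continuous T cT M TM).
  apply: (convolution_continuous T cT M M0 TM (fun s => f s (x s))
    (fun L => c0 + c1 * r L)) => // L L0.
  split => //; first exact: f_meas.
  exact: duhamel_bounded_source (admissible_le x L ax).
move=> t t0; apply: (le_trans (ler_normD _ _)).
have yt : `|y t| <= \int[leb]_(s in `[0, t]) (a * b * expR (b * s)).
  apply: (has_bochner_integral_norm_le_Rintegral t _ _ _ (b * r t) t0 (hy t t0)).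
  - have := measurable_funM (measurable_cst b : measurable_fun `[0, t] _)
      (r_measurable `[0, t]).
    by rewrite /r; congr measurable_fun; apply/funext => s/=; rewrite mulrCA mulrA.
  - move=> s /andP[s0 st]; have -> : a * b * expR (b * s) = b * r s by rewrite /r mulrCA mulrA.
    by rewrite mulr_ge0 ?(ltW b0) ?(ltW (r_gt0 s))//= ler_pM2l// r_mono.
  apply: ae_imp f_growth _ => s fs st.
  have := st; rewrite /= in_itv/= => /andP[s0 sltt].
  have ts : 0 <= t - s by rewrite subr_ge0.
  apply: (le_trans (TM _ _ ts)).
  apply: (@le_trans _ _ (M * (c0 + c1 * r s))).
    rewrite ler_wpM2l//; apply: (le_trans (fs (segment_subset_half_line t _ st) _)).
    by rewrite lerD2l ler_wpM2l// xr.
  have r1 : 1 <= r s by apply: (le_trans a1); exact: r_ge_a.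
  have -> : a * b * expR (b * s) = b * r s by rewrite /r mulrCA mulrA.
  apply: (@le_trans _ _ (M * (c0 + c1) * r s)).
    rewrite -mulrA ler_wpM2l// mulrDl lerD2r.
    by rewrite -{1}(mulr1 c0) ler_wpM2l.
  by rewrite ler_wpM2r ?(ltW (r_gt0 s))// /b lerDl.
rewrite integral_expR// mulfK ?gt_eqF// in yt.
apply: (le_trans (lerD (TM _ _ t0) yt)).
rewrite mulrBr mulr1 -/(r t) /a.
by rewrite addrCA gerDl opprD addrA subrr add0r oppr_le0.
Qed.

(** On [[0, L]] all iterates lie in the ball of radius [r L], where [f] has some
Lipschitz constant [l].  Measured against [expR (lam * t)] with [lam > 2 * M * l],
the Picard map halves distances, so the iterates form a geometrically convergent
sequence. *)
Lemma duhamel_exists : exists x, {within Rp, continuous x} /\ duhamel x0 x x.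
Proof.
have [x|Phi hPhi] := @choice _ _
    (fun x x' => admissible x -> admissible x' /\ duhamel x0 x x').
  have [/picard_step[x' h]|nx] := pselect (admissible x); first by exists x'.
  by exists x.
pose xn n := iter n Phi (fun t => T t x0).
have adm0 : admissible (fun t => T t x0).
  split; first exact: (orbit_continuous T cT M TM).
  move=> t t0; apply: (le_trans (TM _ _ t0)); apply: le_trans (r_ge_a t t0).
  by rewrite lerDl.
have adm n : admissible (xn n) by elim: n => [|n /hPhi[]].
have dxn n : duhamel x0 (xn n) (xn n.+1) by have [] := hPhi _ (adm n).
have step L : 0 <= L -> exists2 A, 0 <= A &
    forall n t, 0 <= t <= L -> `|xn n.+1 t - xn n t| <= A * 2^-1 ^+ n.
  move=> L0; have [l l0 fl] := f_lip _ (r_gt0 L).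
  (* [M * l / lam <= 1/2]; the summand 1 keeps [lam] positive when [M * l = 0]. *)
  pose lam := 2 * (M * l) + 1.
  have Ml0 : 0 <= M * l by rewrite mulr_ge0.
  have lam0 : 0 < lam by rewrite /lam ltr_wpDl// mulr_ge0.
  pose A0 := r L + r L.
  have A00 : 0 <= A0 by rewrite addr_ge0// ltW.
  pose h n s := A0 * 2^-1 ^+ n * expR (lam * s).
  have p2 n : 0 <= 2^-1 ^+ n :> R by rewrite exprn_ge0.
  have mh n : measurable_fun `[0, L] (h n).
    apply: (@measurable_funS _ _ _ _ setT) => //.
    apply: continuous_measurable_fun => s; apply: cvgMl_tmp.
    apply: continuous_comp; last exact: continuous_expR.
    by apply: cvgMl_tmp.
  have hL n t : t <= L -> h n t <= A0 * 2^-1 ^+ n * expR (lam * L).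
    by move=> tL; rewrite ler_wpM2l ?mulr_ge0// ler_expR ler_pM2l.
  have hn n t : 0 <= t <= L -> `|xn n.+1 t - xn n t| <= h n t.
    elim: n t => [|n IH] t tL.
      have tL' := tL; case/andP: tL' => t0 _.
      apply: (@le_trans _ _ A0).
        apply: (le_trans (ler_normB _ _)).
        by apply: lerD; exact: admissible_le tL.
      rewrite /h expr0 mulr1; apply: ler_peMr => //.
      by rewrite -expR0 ler_expR mulr_ge0// (ltW lam0).
    have := duhamel_dist_le x0 (xn n.+1) (xn n) _ _ L (r L) l (h n) _ l0 fl
      (admissible_le _ L (adm n.+1)) (admissible_le _ L (adm n)) (mh n)
      (fun s sL => hL n s (proj2 (andP sL))) IH (dxn n.+1) (dxn n) t tL.
    move=> /le_trans; apply.
    have -> : \int[leb]_(s in `[0, t]) (M * l * h n s) =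
      \int[leb]_(s in `[0, t]) (M * l * (A0 * 2^-1 ^+ n) * expR (lam * s)).
      by apply: eq_Rintegral => s _; rewrite /h !mulrA.
    rewrite integral_expR//; last by case/andP: tL.
    rewrite /h exprS.
    have e0 := expR_gt0 (lam * t).
    have hl : M * l / lam <= 2^-1.
      by rewrite ler_pdivrMr// /lam; lra.
    apply: (@le_trans _ _ (M * l / lam * (A0 * 2^-1 ^+ n * expR (lam * t)))).
      rewrite [leLHS](_ : _ = M * l / lam * (A0 * 2^-1 ^+ n * (expR (lam * t) - 1))).
        rewrite ler_wpM2l ?divr_ge0 ?(ltW lam0)// ler_wpM2l ?mulr_ge0//.
        by rewrite gerBl.
      by rewrite -!mulrA; congr (_ * (_ * _)); ring.
    rewrite [leRHS](_ : _ = 2^-1 * (A0 * 2^-1 ^+ n * expR (lam * t))); last by ring.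
    by rewrite ler_wpM2r// !mulr_ge0// ltW.
  exists (A0 * expR (lam * L)); first by rewrite mulr_ge0// expR_ge0.
  move=> n t tL; apply: (le_trans (hn n t tL)).
  by rewrite mulrAC; apply: hL; case/andP: tL.
have cauchy L : 0 <= L -> exists2 A, 0 <= A &
    forall n k t, 0 <= t <= L -> `|xn (n + k)%N t - xn n t| <= A * 2^-1 ^+ n.
  move=> L0; have [A A0 hA] := step L L0; exists (2 * A); first by rewrite mulr_ge0.
  move=> n k t tL.
  suff : `|xn (n + k)%N t - xn n t| <= 2 * A * (2^-1 ^+ n - 2^-1 ^+ (n + k)%N).
    move=> /le_trans; apply; rewrite ler_wpM2l ?mulr_ge0//.
    by rewrite gerBl exprn_ge0.
  elim: k => [|k IH]; first by rewrite addn0 !subrr normr0 mulr0.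
  rewrite addnS -(subrKA (xn (n + k)%N t)).
  apply: (le_trans (ler_normD _ _)).
  apply: (le_trans (lerD (hA _ _ tL) IH)).
  by rewrite exprS le_eqVlt; apply/orP; left; apply/eqP; field.
have geo0 : (2^-1 ^+ n : R) @[n --> \oo] --> 0.
  by apply: cvg_expr; rewrite ger0_norm// invf_lt1// ltr1n.
have xcvg t : 0 <= t -> cvg (xn n t @[n --> \oo]).
  move=> t0; have [A A0 hA] := cauchy t t0.
  have tt : 0 <= t <= t by rewrite t0 lexx.
  apply: (cvg_of_cauchy_le _ (fun n => A * 2^-1 ^+ n)).
    by rewrite -(mulr0 A); apply: cvgMl_tmp.
  have g0 n : 0 <= A * 2^-1 ^+ n by rewrite mulr_ge0// exprn_ge0.
  move=> n m; have [nm|/ltnW mn] := leqP n m.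
    rewrite distrC -(subnKC nm); apply: (le_trans (hA _ _ _ tt)).
    by rewrite lerDl.
  by rewrite -(subnKC mn); apply: (le_trans (hA _ _ _ tt)); rewrite lerDr.
pose x t := lim (xn n t @[n --> \oo]).
have xlim t : 0 <= t -> xn n t @[n --> \oo] --> x t by exact: xcvg.
have unif L : 0 <= L -> exists2 A, 0 <= A &
    forall n t, 0 <= t <= L -> `|x t - xn n t| <= A * 2^-1 ^+ n.
  move=> L0; have [A A0 hA] := cauchy L L0; exists A => // n t tL.
  have t0 : 0 <= t by case/andP: tL.
  have : `|xn (n + k)%N t - xn n t| @[k --> \oo] --> `|x t - xn n t|.
    apply: cvg_norm; apply: cvgB; last exact: cvg_cst.
    move=> B /(xlim t t0 B)[N _ hN]; exists N => // k Nk; apply: hN.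
    exact: leq_trans Nk (leq_addl _ _).
  move=> /cvgr_to_le; apply; apply: nearW => k; exact: hA.
have cx : {within Rp, continuous x}.
  apply: within_continuous_of_seq => u t Dt Du unt ut.
  have t0 : 0 <= t by move: Dt; rewrite /= in_itv/= andbT.
  have u0 n : 0 <= u n by have := Du n; rewrite /= in_itv/= andbT.
  have [A A0 hA] := unif (t + 1) (addr_ge0 t0 ler01).
  apply/cvgrPdist_lt => e e0.
  have e30 : 0 < e / 3 by rewrite divr_gt0.
  have [N hN] : exists N, A * 2^-1 ^+ N < e / 3.
    have : (A * 2^-1 ^+ n) @[n --> \oo] --> 0.
      by rewrite -(mulr0 A); apply: cvgMl_tmp.
    move=> /cvgrPdist_lt/(_ _ e30)[N _ /(_ N (leqnn N))]; rewrite sub0r normrN => hN.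
    by exists N; apply: le_lt_trans hN; exact: ler_norm.
  have [K _ hK] := (cvgrPdist_lt _ _).1
    (within_continuous_seq _ _ u t (adm N).1 Dt Du ut) _ e30.
  exists K => // n /hK /= h.
  have un1 : 0 <= u n <= t + 1.
    rewrite u0/=; have := unt n; rewrite ltr_distl => /andP[_ /ltW/le_trans]; apply.
    by rewrite lerD2l invf_le1// ler1n.
  have h1 := hA N t; rewrite t0 lerDl/= in h1.
  have {}h1 := h1 ler01; have h2 := hA N (u n) un1.
  rewrite -(subrKA (xn N t)) -(subrKA (xn N (u n)) (xn N t)).
  rewrite (_ : e = e / 3 + (e / 3 + e / 3)); last by field.
  apply: (le_lt_trans (ler_normD _ _)); apply: ltrD; first exact: le_lt_trans hN.
  apply: (le_lt_trans (ler_normD _ _)); apply: ltrD => //.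
  by rewrite distrC; exact: le_lt_trans hN.
have ax : admissible x.
  split => // t t0.
  have : `|xn n t| @[n --> \oo] --> `|x t| by apply: cvg_norm; exact: xlim.
  move=> /cvgr_to_le; apply.
  by apply: nearW => n; exact: (adm n).2.
exists x; split => // t t0.
have [x' [[cx' _] dx']] := picard_step x ax.
have [y [hy x'E]] := dx' t t0; exists y; split => //; rewrite -x'E.
have tt : 0 <= t <= t by rewrite t0 lexx.
have [A A0 hA] := unif t t0.
have [l l0 fl] := f_lip _ (r_gt0 t).
have l1 : xn n.+1 t @[n --> \oo] --> x t.
  move=> C /(xlim t t0 C)[N _ hN]; exists N => // k Nk; apply: hN.
  exact: leq_trans Nk (leqnSn _).
suff l2 : xn n.+1 t @[n --> \oo] --> x' t.
  exact: (cvg_unique (@norm_hausdorff _ _) l1 l2).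
apply: (cvg_of_norm_le _ _ (fun n => M * l * (A * 2^-1 ^+ n) * t)).
  rewrite -(mul0r t) -(mulr0 (M * l)); apply: cvgMr_tmp; apply: cvgMl_tmp.
  by rewrite -(mulr0 A); apply: cvgMl_tmp.
move=> n; have := duhamel_dist_le x0 (xn n) x _ _ t (r t) l
   (fun=> A * 2^-1 ^+ n) _ l0 fl (admissible_le _ t (adm n)) (admissible_le _ t ax)
   (measurable_cst _) (fun _ _ => lexx _) _ (dxn n) dx' t tt.
rewrite Rintegral_cst//= lebesgue_measure_segment//=; apply.
by move=> s st; rewrite distrC; exact: hA.
Qed.
End Existence.
End WellPosed.

(** * Comparison functions and polynomial weights *)

Section Comparison.
Context {R : realType}.
Local Notation leb := (@lebesgue_measure R).

Lemma class_K_ge0 (mu : R -> R) r : class_K mu -> 0 <= r -> 0 <= mu r.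
Proof.
move=> [_ mono mu0]; rewrite le_eqVlt => /predU1P[<-|r0]; first by rewrite mu0.
by rewrite -mu0 ltW// mono.
Qed.

Lemma class_K_le (mu : R -> R) r s : class_K mu -> 0 <= r -> r <= s -> mu r <= mu s.
Proof.
move=> [_ mono _] r0; rewrite le_eqVlt => /predU1P[->//|rs].
by rewrite ltW// mono.
Qed.

Lemma class_K_comp_measurable (mu : R -> R) (D : set R) (g : R -> R) :
  class_K mu -> (forall t, 0 <= g t) -> measurable_fun D g ->
  measurable_fun D (fun t => mu (g t)).
Proof.
move=> [cmu _ _] g0 mg.
rewrite -[X in measurable_fun _ X]/(mu \o g).
apply: (@measurable_comp _ _ _ _ _ _ [set` `[(0 : R), +oo[]) => //.
  by move=> _ [t _ <-]; rewrite /= in_itv/= andbT.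
exact: subspace_continuous_measurable_fun.
Qed.

Lemma class_K_add_id (mu : R -> R) : class_K mu -> class_K (fun r => r + mu r).
Proof.
move=> [cmu mono mu0]; split; last by rewrite mu0 addr0.
  by apply: within_continuous_add => //; apply: continuous_subspaceT => x.
by move=> r s r0 rs; rewrite ltrD// mono.
Qed.

Context (beta : R) (beta0 : 0 < beta).

Lemma cvg_sqr {I : Type} (F : set_system I) (FF : Filter F) (g : I -> R) (l : R) :
  g x @[x --> F] --> l -> (g x) ^+ 2 @[x --> F] --> l ^+ 2.
Proof.
by move=> gl; rewrite expr2; under eq_fun do rewrite expr2; exact: cvgM.
Qed.

(** The absolute value makes the weight positive and continuous on the whole
line. *)
Definition weight (t : R) : R := (1 + `|t|) `^ beta.

Lemma weight_ge1 t : 1 <= weight t.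
Proof.
rewrite -(@powRr0 R (1 + `|t|)) /weight; apply: ler_powR; last exact: ltW.
by rewrite lerDl.
Qed.

Lemma weight_gt0 t : 0 < weight t.
Proof. exact: lt_le_trans (weight_ge1 t). Qed.

Lemma weight_lt s t : 0 <= s -> s < t -> weight s < weight t.
Proof.
move=> s0 st; have t0 : 0 <= t by rewrite ltW// (le_lt_trans s0).
rewrite /weight !ger0_norm//; apply: gt0_ltr_powR => //.
- by rewrite nnegrE addr_ge0.
- by rewrite nnegrE addr_ge0.
- by rewrite ltrD2l.
Qed.

(** This is [1 + t <= (t - s + 1) * (1 + s)], with the power [beta] taken. *)
Lemma weight_submul s t : 0 <= s -> s <= t ->
  weight t <= (t - s + 1) `^ beta * weight s.
Proof.
move=> s0 st; have t0 := le_trans s0 st.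
have ts1 : 0 <= t - s + 1 by lra.
have s1 : 0 <= 1 + s by lra.
rewrite /weight !ger0_norm// -powRM//; apply: ge0_ler_powR.
- exact: ltW.
- by rewrite nnegrE addr_ge0.
- by rewrite nnegrE mulr_ge0.
- rewrite -subr_ge0 (_ : _ - _ = (t - s) * s) ?mulr_ge0 ?subr_ge0//.
  by ring.
Qed.

Lemma weight_continuous : continuous weight.
Proof.
have p0 (t : R) : 0 < 1 + `|t| by rewrite (lt_le_trans ltr01)// lerDl.
have -> : weight = fun t => expR (beta * ln (1 + `|t|)).
  by apply/funext => t; rewrite /weight /powR gt_eqF.
have cln : continuous (fun t : R => ln (1 + `|t|)).
  move=> t; apply: (@continuous_comp _ _ _ (fun t : R => 1 + `|t|) (@ln R)).
    by apply: cvgD; [exact: cvg_cst|apply: (@cvg_norm _ R^o)].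
  exact: continuous_ln.
move=> t; apply: continuous_comp; last exact: continuous_expR.
by apply: cvgMl_tmp; exact: cln.
Qed.

Lemma weight_inv_continuous : continuous (fun t => (weight t)^-1).
Proof.
move=> t; apply: cvgV; first by rewrite gt_eqF// weight_gt0.
exact: weight_continuous.
Qed.

Lemma weight_inv_cvg0 : (weight t)^-1 @[t --> +oo] --> 0.
Proof.
apply/cvgrPdist_lt => e e0; exists (e^-1 `^ (beta^-1)); split.
  exact: num_real.
move=> t et; have t0 : 0 <= t by rewrite (le_trans _ (ltW et))// powR_ge0.
rewrite sub0r normrN ger0_norm ?invr_ge0 ?(ltW (weight_gt0 t))//.
rewrite -[ltRHS]invrK ltf_pV2 ?posrE ?weight_gt0 ?invr_gt0//.
have : (e^-1 `^ beta^-1) `^ beta < weight t.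
  rewrite /weight ger0_norm//; apply: gt0_ltr_powR => //.
  - by rewrite nnegrE powR_ge0.
  - by rewrite nnegrE addr_ge0.
  - by rewrite (lt_trans et)// ltrDr.
by rewrite -powRrM mulVf ?gt_eqF// powRr1// invr_ge0 ltW.
Qed.

Lemma weight_inv_le_powR t : 0 < t -> (weight t)^-1 <= t `^ (- beta).
Proof.
move=> t0; rewrite powRN lef_pV2 ?posrE ?weight_gt0 ?powR_gt0//.
rewrite /weight (gtr0_norm t0); apply: ge0_ler_powR.
- exact: ltW.
- by rewrite nnegrE ltW.
- by rewrite nnegrE addr_ge0// ltW.
- by rewrite lerDr.
Qed.

Lemma powR_le_weight_inv t : 1 <= t -> t `^ (- beta) <= 2 `^ beta * (weight t)^-1.
Proof.
move=> t1; have t0 : 0 < t by exact: lt_le_trans t1.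
rewrite powRN ler_pdivlMr ?weight_gt0// mulrC ler_pdivrMr ?powR_gt0//.
rewrite -powRM ?(ltW t0)// /weight (gtr0_norm t0); apply: ge0_ler_powR.
- exact: ltW.
- by rewrite nnegrE addr_ge0// ltW.
- by rewrite nnegrE mulr_ge0// ltW.
- lra.
Qed.

Lemma add_sqr_lt (x y : R) : 0 <= x -> x < y -> x + x ^+ 2 < y + y ^+ 2.
Proof. by move=> x0 xy; rewrite ltrD// ltr_pXn2r// nnegrE ltW// (le_lt_trans x0). Qed.

(** The form [z + z ^+ 2] is dictated by [young_gain]. *)
Definition decay_gain (C r t : R) : R := 
  C * r * (weight t)^-1 + (C * r * (weight t)^-1) ^+ 2.

Lemma decay_gain_KL C : 0 < C -> class_KL (decay_gain C).
Proof.
move=> C0; have iw0 t : 0 < (weight t)^-1 by rewrite invr_gt0 weight_gt0.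
have cz : continuous (fun p : R * R => C * p.1 * (weight p.2)^-1).
  move=> p; apply: cvgM; first by apply: cvgMl_tmp; exact: cvg_fst.
  apply: (@continuous_comp _ _ _ snd (fun t => (weight t)^-1)).
    exact: cvg_snd.
  exact: weight_inv_continuous.
have cg : continuous (fun p : R * R => decay_gain C p.1 p.2).
  move=> p; apply: cvgD; first exact: cz.
  by apply: cvg_sqr; exact: cz.
split; first exact: continuous_subspaceT.
- move=> t t0; split; last by rewrite /decay_gain mulr0 mul0r expr0n addr0.
    have czt : continuous (fun r => C * r * (weight t)^-1).
      by move=> r; apply: cvgMr_tmp; apply: cvgMl_tmp.
    apply: continuous_subspaceT => r.
    by apply: cvgD; [exact: czt|apply: cvg_sqr; exact: czt].
  move=> r s r0 rs; rewrite /decay_gain.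
  have h : C * r * (weight t)^-1 < C * s * (weight t)^-1 by rewrite ltr_pM2r// ltr_pM2l.
  by apply: add_sqr_lt => //; rewrite !mulr_ge0 ?(ltW C0) ?(ltW (iw0 t)).
move=> r r0; split.
- have czr : continuous (fun t => C * r * (weight t)^-1).
    by move=> t; apply: cvgMl_tmp; exact: weight_inv_continuous.
  apply: continuous_subspaceT => t.
  by apply: cvgD; [exact: czr|apply: cvg_sqr; exact: czr].
- by move=> t t0; rewrite /decay_gain addr_ge0 ?sqr_ge0// !mulr_ge0 ?ltW.
- move=> s t s0 st; rewrite /decay_gain.
  have h : C * r * (weight t)^-1 < C * r * (weight s)^-1.
    by rewrite ltr_pM2l ?mulr_gt0// ltf_pV2 ?posrE ?weight_gt0// weight_lt.
  by apply: add_sqr_lt => //; rewrite !mulr_ge0 ?(ltW C0) ?(ltW r0) ?(ltW (iw0 _)).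
have z0 : C * r * (weight t)^-1 @[t --> +oo] --> 0.
  by rewrite -(mulr0 (C * r)); apply: cvgMl_tmp; exact: weight_inv_cvg0.
rewrite /decay_gain -(addr0 0); apply: cvgD => //.
by have := cvg_sqr _ _ _ _ z0; rewrite expr2 mulr0; apply.
Qed.

Lemma decay_gain_bigO C r : 0 < C -> 0 < r ->
  bigO_infty (decay_gain C r) (fun t => t `^ (- beta)).
Proof.
move=> C0 r0; exists (C * r + (C * r) ^+ 2), 1; split.
  by rewrite addr_gt0 ?exprn_gt0 ?mulr_gt0.
move=> t t1; have t0 : 0 < t by exact: lt_le_trans t1.
have w1 := weight_ge1 t; have wp := weight_inv_le_powR t t0.
have iw1 : (weight t)^-1 <= 1 by rewrite invf_le1 ?weight_gt0.
have iw0 : 0 <= (weight t)^-1 by rewrite invr_ge0 ltW// weight_gt0.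
apply: (@le_trans _ _ ((C * r + (C * r) ^+ 2) * (weight t)^-1)); last first.
  by rewrite ler_wpM2l// addr_ge0 ?sqr_ge0// mulr_ge0// ltW.
rewrite /decay_gain mulrDl lerD2l exprMn expr2 ler_wpM2l ?sqr_ge0//.
by rewrite expr2 ler_piMr.
Qed.

Definition input_gain (b k m : R) : R :=
  m * (1 + b * expR (k * m)) + (expR (k * m) - 1) ^+ 2.

Lemma input_gain_Kinf b k : 0 <= b -> 0 <= k -> class_Kinf (input_gain b k).
Proof.
move=> b0 k0.
have ce : continuous (fun m : R => expR (k * m)).
  move=> m; apply: continuous_comp; last exact: continuous_expR.
  by apply: cvgMl_tmp.
split; last first.
  move=> N; exists (`|N| + 1); split; first by rewrite addr_ge0.
  apply: (@lt_le_trans _ _ (`|N| + 1)).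
    by rewrite (le_lt_trans (ler_norm N))// ltrDl.
  rewrite /input_gain -[leLHS]addr0 lerD ?sqr_ge0// ler_peMr ?addr_ge0//.
  by rewrite lerDl mulr_ge0 ?expR_ge0.
split; last by rewrite /input_gain mul0r mulr0 expR0 subrr expr0n addr0.
  apply: continuous_subspaceT => m; apply: cvgD.
    apply: cvgM => //; apply: cvgD; first exact: cvg_cst.
    by apply: cvgMl_tmp; exact: ce.
  by apply: cvg_sqr; apply: cvgB; [exact: ce|exact: cvg_cst].
move=> r s r0 rs; have rs' := ltW rs; have s0 := le_lt_trans r0 rs.
have e1 m : 0 <= m -> 1 <= expR (k * m).
  by move=> m0; rewrite -expR0 ler_expR mulr_ge0.
have ers : expR (k * r) <= expR (k * s) by rewrite ler_expR ler_wpM2l.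
have er := e1 r r0.
rewrite /input_gain; apply: ltr_leD.
  apply: (@lt_le_trans _ _ (s * (1 + b * expR (k * r)))).
    by rewrite ltr_pM2r// ltr_pwDl// mulr_ge0 ?expR_ge0.
  by rewrite ler_pM2l// lerD2l ler_wpM2l.
by rewrite lerXn2r ?nnegrE ?subr_ge0 ?lerD2r// (le_trans er).
Qed.

(** With [z = C * r / weight t] and [E = expR (k * m)], this is
[z * (E - 1) <= z ^+ 2 + (E - 1) ^+ 2].  The summand [m] of [input_gain] makes it
strictly increasing and unbounded even when [b] and [k] vanish. *)
Lemma young_gain (C r b k t m : R) : 0 <= m ->
  (C * r * (weight t)^-1 + b * m) * expR (k * m) <=
  decay_gain C r t + input_gain b k m.
Proof.
move=> m0; rewrite /decay_gain /input_gain.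
set z := C * r * _; set E := expR _.
rewrite -subr_ge0 (_ : _ - _ = m + (z ^+ 2 - z * (E - 1) + (E - 1) ^+ 2)).
  by rewrite addr_ge0//; set y := E - 1; nra.
by ring.
Qed.

End Comparison.

(** * Decay of classical orbits *)

Lemma semi_uniformly_stable_bound {R : realType} {X : completeNormedModType R}
  (T : R -> X -> X) : semi_uniformly_stable T ->
  exists2 M, 0 <= M & forall t x, 0 <= t -> `|T t x| <= M * `|x|.
Proof.
move=> [[bT _ _ _] [M TM] _]; exists `|M| => // t x t0.
apply: (le_trans (opnorm_le _ x (bT t t0))); rewrite ler_wpM2r//.
by rewrite (le_trans (TM t t0))// ler_norm.
Qed.

(** For large times write [x] as the inverse of A applied to A x; for small times
the uniform bound of the semigroup suffices, as the weight is bounded there. *)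
Lemma polynomially_stable_orbit_decay {R : realType} {X : completeNormedModType R}
  (T : R -> X -> X) (alpha : R) : 0 < alpha -> polynomially_stable alpha T ->
  exists2 C, 0 < C & forall x t, gen_dom T x -> 0 <= t ->
    `|T t x| <= C * graph_norm T x * (weight alpha^-1 t)^-1.
Proof.
move=> alpha0 [sT [S [[bS _ SA] [D [t0 [D0 TD]]]]]].
have b0 : 0 < alpha^-1 by rewrite invr_gt0.
have [M M0 TM] := semi_uniformly_stable_bound T sT.
have [[bT _ _ _] _ _] := sT.
(* From time 1 on, [t] and [1 + t] are comparable. *)
pose t1 := Num.max t0 1.
have P0 t : 0 <= (weight alpha^-1 t)^-1 by rewrite invr_ge0 ltW// weight_gt0.
have w0 t := weight_gt0 alpha^-1 b0 t.
pose C1 := D * 2 `^ alpha^-1; pose C2 := M * weight alpha^-1 t1.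
have C10 : 0 <= C1 by rewrite mulr_ge0 ?powR_ge0// ltW.
have C20 : 0 <= C2 by rewrite mulr_ge0// ltW.
exists (C1 + C2 + 1) => [|x t xD tge0]; first by rewrite ltr_wpDl// addr_ge0.
have gn0 : 0 <= graph_norm T x by rewrite addr_ge0.
have [t1t|tt1] := leP t1 t.
  have [t0t t1'] : t0 <= t /\ 1 <= t.
    by move: t1t; rewrite ge_max => /andP[].
  have bTS : bounded_linear (T t \o S).
    have [lT _] := bT t tge0; have [lS [N SN]] := bS.
    split; first by move=> c y z; rewrite /= lS lT.
    exists (M * N) => y; rewrite -mulrA.
    by apply: (le_trans (TM _ _ tge0)); rewrite ler_wpM2l.
  have := opnorm_le _ (gen T x) bTS; rewrite /= SA// => /le_trans; apply.
  apply: (@le_trans _ _ (C1 * (weight alpha^-1 t)^-1 * graph_norm T x)).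
    apply: ler_pM => //.
    - exact: opnorm_ge0.
    - apply: (le_trans (TD t t0t)); rewrite /C1 -mulrA ler_pM2l//.
      exact: powR_le_weight_inv.
    - by rewrite /graph_norm lerDr.
  rewrite mulrAC ler_wpM2r// ler_wpM2r//.
  by rewrite -addrA lerDl addr_ge0.
apply: (le_trans (TM t x tge0)).
apply: (@le_trans _ _ (C2 * (weight alpha^-1 t)^-1 * graph_norm T x)).
  apply: ler_pM => //; last by rewrite /graph_norm lerDl.
  rewrite /C2 -mulrA ler_peMr// ler_pdivlMr// mul1r.
  by rewrite ltW// weight_lt.
rewrite mulrAC ler_wpM2r// ler_wpM2r//.
by rewrite (addrC C1) -addrA lerDl addr_ge0.
Qed.

(** * Bilinear systems *)

Section Bilinear.
Context {R : realType} {X U : completeNormedModType R}.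
Local Notation leb := (@lebesgue_measure R).
Local Notation "'Rp'" := (`[0%R, +oo[%classic : set R).
Context (T : R -> X -> X) (cT : C0_semigroup T) (M : R) (M0 : 0 <= M)
  (TM : forall t x, 0 <= t -> `|T t x| <= M * `|x|).
Context (F : X -> U -> X) (B : U -> X) (G : X -> U -> X)
  (lB : bounded_linear B) (N : R) (N0 : 0 <= N) (BN : forall v, `|B v| <= N * `|v|)
  (FE : forall xi v, F xi v = B v + G xi v)
  (G_meas : forall tau : R, 0 < tau -> forall (f : R -> X) (g : R -> U),
     {within `[0, tau], continuous f} -> Linfty `[0, tau] g ->
     strongly_measurable `[0, tau] (fun t => G (f t) (g t))).
Context (beta : R) (beta0 : 0 < beta) (K : R) (K0 : 0 < K) (chi : R -> R)
  (chiK : class_K chi)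
  (G_decay : forall xi v t, 0 <= t ->
     `|T t (G xi v)| <= K * `|xi| * chi `|v| / (t + 1) `^ beta).

Let chi0 v : 0 <= chi `|v : U|. Proof. exact: class_K_ge0. Qed.

(** The decay hypothesis at time zero. *)
Lemma nonlinearity_growth xi v : `|G xi v| <= K * `|xi| * chi `|v|.
Proof.
have := G_decay xi v 0 (lexx 0); have [_ -> _ _] := cT.
by rewrite add0r powR1/= divr1.
Qed.

Lemma essential_bound (D : set R) (u : R -> U) : Linfty D u ->
  exists2 m, 0 <= m & {ae leb, forall t, D t -> `|u t| <= m}.
Proof.
move=> [_ [m um]]; exists `|m| => //.
by apply: ae_imp um _ => t um /um/le_trans; apply; exact: ler_norm.
Qed.

Lemma bilinear_source_measurable u (x : R -> X) L : input u ->
  {within Rp, continuous x} -> 0 <= L ->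
  strongly_measurable `[0, L] (fun s => F (x s) (u s)).
Proof.
move=> hu cx L0.
rewrite (_ : (fun s => _) = (fun s => B (u s) + G (x s) (u s))); last first.
  by apply/funext => s; rewrite FE.
have subL L' : `[0, L']%classic `<=` Rp := segment_subset_half_line L'.
have [su [m um]] := hu.
apply: strongly_measurable_add.
  apply: strongly_measurable_bounded_linear => //.
  exact: strongly_measurable_subset su.
apply: (@strongly_measurable_subset _ _ `[0, L + 1]).
  by move=> s; rewrite /= !in_itv/= => /andP[-> /le_trans]; apply; rewrite lerDl.
apply: G_meas; first by rewrite ltr_wpDl.
  exact: continuous_subspaceW cx.
split; first exact: strongly_measurable_subset su.
by exists m; exact: ae_subset um.
Qed.

Lemma bilinear_forward_complete :
  (forall r : R, 0 < r ->
     exists (K_r : R) (chi_r : R -> R), 0 < K_r /\ class_K chi_r /\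
     forall (xi zeta : X) (v : U), `|xi| <= r -> `|zeta| <= r ->
       `|G xi v - G zeta v| <= K_r * `|xi - zeta| * chi_r `|v|) ->
  forward_complete T F.
Proof.
move=> G_lip x0 u hu; have [m m0 um] := essential_bound _ _ hu.
pose f s xi := F xi (u s).
have c10 : 0 <= K * chi m by rewrite mulr_ge0 ?(ltW K0)//; exact: class_K_ge0.
have c00 : 0 <= N * m by rewrite mulr_ge0.
have fm (x : R -> X) : {within Rp, continuous x} ->
    forall L, 0 <= L -> strongly_measurable `[0, L] (fun s => f s (x s)).
  by move=> cx L L0; exact: bilinear_source_measurable.
have fg : {ae leb, forall s, Rp s -> forall xi,
    `|f s xi| <= N * m + K * chi m * `|xi|}.
  apply: ae_imp um _ => s um Rs xi; rewrite /f FE.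
  apply: (le_trans (ler_normD _ _)); apply: lerD.
    by apply: (le_trans (BN _)); rewrite ler_wpM2l// um.
  apply: (le_trans (nonlinearity_growth _ _)); rewrite mulrAC ler_wpM2r//.
  by rewrite ler_wpM2l ?(ltW K0)// class_K_le// um.
have fl r : 0 < r -> exists2 l, 0 <= l & {ae leb, forall s, Rp s ->
    forall xi zeta, `|xi| <= r -> `|zeta| <= r ->
    `|f s xi - f s zeta| <= l * `|xi - zeta|}.
  move=> r0; have [Kr [chir [Kr0 [chirK lip]]]] := G_lip r r0.
  exists (Kr * chir m); first by rewrite mulr_ge0 ?(ltW Kr0)//; exact: class_K_ge0.
  apply: ae_imp um _ => s um Rs xi zeta xr zr; rewrite /f !FE.
  rewrite opprD addrACA subrr add0r; apply: (le_trans (lip _ _ _ xr zr)).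
  rewrite mulrAC ler_wpM2r// ler_wpM2l ?(ltW Kr0)// class_K_le//.
  exact: um.
have [x [cx dx]] := duhamel_exists T cT M M0 TM f _ _ c00 c10 fm fg fl x0.
exists x; split; first by split.
move=> x' [cx' dx'].
exact: (duhamel_unique T cT M M0 TM f fl x0 x x').
Qed.

Lemma bilinear_stable_at_zero x0 (phi : R -> X) t :
  mild_solution T F x0 (fun=> 0) phi -> 0 <= t -> `|phi t| <= M * `|x0|.
Proof.
move=> [_ hphi] t0; have [y [hy ->]] := hphi t t0.
have F0 xi : F xi 0 = 0.
  have := nonlinearity_growth xi 0; rewrite normr0.
  have [_ _ ->] := chiK; rewrite mulr0 normr_le0 FE => /eqP ->.
  by rewrite addr0 linear_zero//; have [] := lB.
have [bT _ _ _] := cT.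
have : `|y| <= \int[leb]_(s in `[0, t]) (cst 0 s).
  apply: (has_bochner_integral_norm_le_Rintegral t _ _ _ 0 t0 hy) => //.
  - by move=> s _; rewrite lexx.
  apply: aeW => s; rewrite /= in_itv/= => /andP[_ st].
  have [|lT _] := bT (t - s); first by rewrite subr_ge0.
  by rewrite F0 linear_zero// normr0.
rewrite Rintegral_cst// mul0r normr_le0 => /eqP ->.
by rewrite addr0 TM.
Qed.

(** Gronwall's inequality for [w s = weight s * |phi s|] on [[0, L]].  The kernel
[(t - s + 1) `^ beta] in the denominator and the weight in front of the integral
cancel by [weight_submul], up to the weight at [s] that belongs to [w s]. *)
Lemma bilinear_estimate x0 u (phi : R -> X) c L :
  0 <= c -> (forall t, 0 <= t -> `|T t x0| <= c * (weight beta t)^-1) ->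
  input u -> mild_solution T F x0 u phi -> 0 <= L -> forall m,
  m = \int[leb]_(s in `[0, L]) (`|u s| + chi `|u s|) ->
  `|phi L| <= (c * (weight beta L)^-1 + M * N * m) * expR (2 * K * m).
Proof.
move=> c0 Tc hu [cphi hphi] L0 m mE0.
have [ubd ubd0 um] := essential_bound _ _ hu.
have [g [lg gb ug]] := bounded_simple_limit_version Rp u ubd (measurable_itv _)
  ubd0 hu.1 um.
have mg : measurable_fun `[0, L] (fun s => `|g s|).
  exact: simple_limit_norm_measurable.
have mchi : measurable_fun `[0, L] (fun s => chi `|g s|).
  exact: class_K_comp_measurable.
have mE : m = \int[leb]_(s in `[0, L]) (`|g s| + chi `|g s|).
  rewrite mE0; congr fine; apply: ae_eq_lower_integral.
  - by move=> s _; rewrite lee_fin addr_ge0.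
  - by move=> s _; rewrite lee_fin addr_ge0.
  - by apply: ae_imp ug _ => s ug /(segment_subset_half_line L)/ug ->.
have chib s : chi `|g s| <= chi ubd by exact: class_K_le.
have ig : leb.-integrable `[0, L] (EFin \o (fun s => `|g s|)).
  by apply: (bounded_integrable_segment _ _ ubd) => // s _; rewrite normr_id.
have ichi : leb.-integrable `[0, L] (EFin \o (fun s => chi `|g s|)).
  by apply: (bounded_integrable_segment _ _ (chi ubd)) => // s _; rewrite ger0_norm.
pose q1 := \int[leb]_(s in `[0, L]) `|g s|.
pose q2 := \int[leb]_(s in `[0, L]) chi `|g s|.
have q10 : 0 <= q1 by apply: Rintegral_ge0.
have q20 : 0 <= q2 by apply: Rintegral_ge0.
have mq : m = q1 + q2 by rewrite mE RintegralD.
have w0 t := weight_gt0 beta beta0 t.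
have wle s t : 0 <= s -> s <= t -> weight beta s <= weight beta t.
  move=> s0; rewrite le_eqVlt => /predU1P[->//|st].
  by rewrite ltW// weight_lt.
pose w s := weight beta s * `|phi s|.
pose k s := K * chi `|g s|.
have k0 s : 0 <= k s by rewrite mulr_ge0// ltW.
have w_ge0 s : 0 <= w s by rewrite mulr_ge0// ltW.
have mk : measurable_fun `[0, L] k by exact: measurable_funM.
have mw : measurable_fun `[0, L] w.
  apply: measurable_funM; last exact: within_continuous_norm_measurable.
  apply: (@measurable_funS _ _ _ _ setT) => //.
  by apply: continuous_measurable_fun; exact: weight_continuous.
have [P P0 phiP] := within_continuous_norm_bounded phi L cphi L0.
have wP s : 0 <= s <= L -> w s <= weight beta L * P.
  move=> sL; have /andP[s0 sltL] := sL.
  by apply: ler_pM => //; [exact: ltW|exact: wle|exact: phiP].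
(* The inhomogeneous term grows with [t], so its value at [L] bounds it. *)
pose c' := c + weight beta L * (M * N * q1).
have c'0 : 0 <= c' by rewrite addr_ge0// !mulr_ge0// ltW.
have ikw : leb.-integrable `[0, L] (EFin \o (fun s => k s * w s)).
  apply: (bounded_integrable_segment _ _ (K * chi ubd * (weight beta L * P))).
    exact: measurable_funM.
  move=> s sL; rewrite ger0_norm; last exact: mulr_ge0.
  apply: ler_pM => //.
    by rewrite ler_wpM2l// ltW.
  exact: wP.
have wineq t : 0 <= t <= L -> w t <= c' + \int[leb]_(s in `[0, t]) (k s * w s).
  move=> tL; have /andP[t0 tltL] := tL.
  have sub : `[0, t]%classic `<=` `[0, L]%classic.
    by move=> s; rewrite /= !in_itv/= => /andP[-> /le_trans]; apply.
  have igt : leb.-integrable `[0, t] (EFin \o (fun s => `|g s|)).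
    exact: integrableS ig.
  have ikwt : leb.-integrable `[0, t] (EFin \o (fun s => k s * w s)).
    exact: integrableS ikw.
  have [y [hy phiE]] := hphi t t0.
  pose h s := M * N * `|g s| + (weight beta t)^-1 * (k s * w s).
  have iw0 : 0 <= (weight beta t)^-1 by rewrite invr_ge0 ltW.
  have yh : `|y| <= \int[leb]_(s in `[0, t]) h s.
    apply: (has_bochner_integral_norm_le_Rintegral t _ _ h (M * N * ubd +
      (weight beta t)^-1 * (K * chi ubd * (weight beta L * P))) t0 hy).
    - apply: (measurable_funS _ sub) => //.
      by apply: measurable_funD; apply: measurable_funM => //; exact: measurable_funM.
    - move=> s /andP[s0 st]; have sL : 0 <= s <= L by rewrite s0 (le_trans st).
      have MNg : 0 <= M * N * `|g s| by rewrite !mulr_ge0.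
      have kw0 : 0 <= (weight beta t)^-1 * (k s * w s).
        by apply: mulr_ge0 => //; exact: mulr_ge0.
      rewrite /h addr_ge0//=; apply: lerD.
        by rewrite ler_wpM2l// mulr_ge0.
      rewrite ler_wpM2l//; apply: ler_pM => //; last exact: wP.
      by rewrite ler_wpM2l// ltW.
    apply: ae_imp ug _ => s ug st; rewrite (ug (segment_subset_half_line t _ st)).
    have : 0 <= s <= t by move: st; rewrite /= in_itv.
    move=> /andP[s0 sltt]; have ts : 0 <= t - s by rewrite subr_ge0.
    have -> : T (t - s) (F (phi s) (g s)) =
        T (t - s) (B (g s)) + T (t - s) (G (phi s) (g s)).
      rewrite FE; have [bT _ _ _] := cT; have [lT _] := bT _ ts.
      by have := lT 1 (B (g s)) (G (phi s) (g s)); rewrite !scale1r.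
    apply: (le_trans (ler_normD _ _)); apply: lerD.
      by apply: (le_trans (TM _ _ ts)); rewrite -mulrA ler_wpM2l.
    apply: (le_trans (G_decay _ _ _ ts)).
    have pos : 0 < (t - s + 1) `^ beta by rewrite powR_gt0// ltr_wpDl.
    rewrite /k /w ler_pdivrMr//.
    rewrite [leRHS](_ : _ = K * `|phi s| * chi `|g s| *
      (((t - s + 1) `^ beta * weight beta s) / weight beta t)); last by ring.
    rewrite ler_peMr//; first by rewrite !mulr_ge0// ltW.
    by rewrite ler_pdivlMr// mul1r; exact: weight_submul.
  have hE : \int[leb]_(s in `[0, t]) h s = M * N * (\int[leb]_(s in `[0, t]) `|g s|)
      + (weight beta t)^-1 * \int[leb]_(s in `[0, t]) (k s * w s).
    rewrite /h RintegralD//.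
    - by rewrite !RintegralZl.
    - exact: (integrableZl _ (M * N) igt).
    - exact: (integrableZl _ (weight beta t)^-1 ikwt).
  have qt : \int[leb]_(s in `[0, t]) `|g s| <= q1.
    rewrite /q1 -subr_ge0 (@integral_segment_split _ (fun s => `|g s|) L t L)//.
    by apply: Rintegral_ge0.
  rewrite /w phiE.
  apply: (@le_trans _ _ (weight beta t * (c * (weight beta t)^-1 +
    (M * N * q1 + (weight beta t)^-1 * \int[leb]_(s in `[0, t]) (k s * w s))))).
    rewrite ler_wpM2l ?(ltW (w0 t))//; apply: (le_trans (ler_normD _ _)).
    apply: lerD; first exact: Tc.
    apply: (le_trans yh); rewrite hE lerD2r; apply: ler_wpM2l => //.
    exact: mulr_ge0.
  rewrite [leLHS](_ : _ = c + weight beta t * (M * N * q1) +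
     \int[leb]_(s in `[0, t]) (k s * w s)).
    by rewrite lerD2r lerD2l ler_wpM2r ?mulr_ge0// wle.
  by field; rewrite gt_eqF.
have := gronwall k w (K * chi ubd) (weight beta L * P) c' L mk mw c'0 _ _ wineq L.
have LL : 0 <= L <= L by rewrite L0 lexx.
move=> /(_ _ _ LL) wL.
have {}wL : w L <= c' * expR (2 * \int[leb]_(s in `[0, L]) k s).
  apply: wL => s sL; last by rewrite w_ge0 wP.
  by rewrite k0/= ler_wpM2l// ltW.
have kq : \int[leb]_(s in `[0, L]) k s = K * q2 by rewrite RintegralZl.
rewrite kq in wL.
have phiL : `|phi L| = (weight beta L)^-1 * w L by rewrite mulKf// gt_eqF.
rewrite phiL; apply: (@le_trans _ _ ((weight beta L)^-1 *
  (c' * expR (2 * (K * q2))))).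
  by rewrite ler_wpM2l// invr_ge0 ltW.
rewrite [leLHS]mulrA; apply: ler_pM.
- by rewrite mulr_ge0// invr_ge0 ltW.
- exact: expR_ge0.
- rewrite /c' mulrDr mulKf ?gt_eqF// mulrC lerD2l; apply: ler_wpM2l.
    exact: mulr_ge0.
  by rewrite mq lerDl.
- by rewrite ler_expR mulrA ler_wpM2l ?mulr_ge0 ?(ltW K0)// mq lerDr.
Qed.

End Bilinear.

Theorem theorem5p3 (R : realType) (X U : completeNormedModType R)
  (alpha : R) (halpha : 0 < alpha)
  (T : R -> X -> X) (hT : polynomially_stable alpha T)
  (F : X -> U -> X) (B : U -> X) (G : X -> U -> X)
  (hB : bounded_linear B)
  (hF : forall (xi : X) (v : U), F xi v = B v + G xi v)
  (hG0 : forall v : U, G 0 v = 0)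
  (hGlip : forall r : R, 0 < r ->
     exists (K_r : R) (chi_r : R -> R), 0 < K_r /\ class_K chi_r /\
     forall (xi zeta : X) (v : U), `|xi| <= r -> `|zeta| <= r ->
       `|G xi v - G zeta v| <= K_r * `|xi - zeta| * chi_r `|v|)
  (hGmeas : forall tau : R, 0 < tau ->
     forall (f : R -> X) (g : R -> U),
       {within `[0, tau], continuous f} -> Linfty `[0, tau] g ->
       strongly_measurable `[0, tau] (fun t => G (f t) (g t)))
  (hGdecay : exists (K : R) (chi : R -> R), 0 < K /\ class_K chi /\
     forall (xi : X) (v : U) (t : R), 0 <= t ->
       `|T t (G xi v)| <= K * `|xi| * chi `|v| / (t + 1) `^ alpha^-1) :
  polynomially_iISS T F alpha.
Proof.
have beta0 : 0 < alpha^-1 by rewrite invr_gt0.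
have [sT _] := hT; have [cT _ _] := sT.
have [M M0 TM] := semi_uniformly_stable_bound T sT.
have [C C0 TC] := polynomially_stable_orbit_decay T alpha halpha hT.
have [K [chi [K0 [chiK Gdecay]]]] := hGdecay.
have [N N0 BN] : exists2 N, 0 <= N & forall v, `|B v| <= N * `|v|.
  have [_ [N BN]] := hB; exists `|N| => // v; apply: (le_trans (BN v)).
  by rewrite ler_wpM2r// ler_norm.
split.
  split.
    exact: (bilinear_forward_complete T cT M M0 TM F B G hB N N0 BN hF hGmeas
      alpha^-1 K K0 chi chiK Gdecay hGlip).
  exists (fun r => (M + 1) * r); split.
    have M1 : 0 < M + 1 by rewrite ltr_wpDl.
    split; last first.
      move=> P; exists (`|P| + 1); split; first by rewrite addr_ge0.
      apply: (@lt_le_trans _ _ (`|P| + 1)).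
        by rewrite (le_lt_trans (ler_norm P))// ltrDl.
      by rewrite ler_peMl ?addr_ge0// lerDr.
    split; last by rewrite mulr0.
      by apply: continuous_subspaceT => r; apply: cvgMl_tmp.
    by move=> r s _ rs; rewrite ltr_pM2l.
  move=> x0 phi hphi t t0.
  apply: (le_trans (bilinear_stable_at_zero T cT M TM F B G hB hF alpha^-1
    K chi chiK Gdecay x0 phi t hphi t0)).
  by rewrite ler_wpM2r// lerDl.
exists (decay_gain alpha^-1 C), (input_gain (M * N) (2 * K)), (fun r => r + chi r).
split.
- exact: decay_gain_KL.
- by apply: input_gain_Kinf; rewrite mulr_ge0// ltW.
- exact: class_K_add_id.
- move=> x0 u phi x0D hu hphi t t0.
  have gn0 : 0 <= graph_norm T x0 by rewrite addr_ge0.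
  apply: le_trans (bilinear_estimate T cT M M0 TM F B G N N0 BN hF alpha^-1 beta0
    K K0 chi chiK Gdecay x0 u phi (C * graph_norm T x0) t _ _ hu hphi t0 _ erefl) _.
  - by rewrite mulr_ge0// ltW.
  - by move=> s s0; exact: TC.
  - apply: young_gain; apply: Rintegral_ge0 => s _.
    by rewrite addr_ge0//; exact: class_K_ge0.
- by move=> r r0; exact: decay_gain_bigO.
Qed.
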